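(* The Bessel family $\{\mathrm{PW}_{\boldsymbol{\theta}}\}_{\boldsymbol{\theta}\in\Theta}$ of propagative plane waves (indexed by $\Theta$ with the surface measure $\sigma$ of $\mathbb{S}^2$) is not a stable continuous approximation for $\mathcal{B}$.
   Context: Fix a real wavenumber $\kappa>0$; $B_1$ is the open unit ball and $\mathbb{S}^2$ the unit sphere of $\mathbb{R}^3$. Functions are complex valued. $\mathcal{B}$ is the space of $u\in H^1(B_1)$ with $\Delta u+\kappa^2u=0$, with norm $\|u\|_{\mathcal{B}}^2=\|u\|_{L^2(B_1)}^2+\kappa^{-2}\|\nabla u\|_{L^2(B_1)^3}^2$ and the associated Hermitian product (equivalently, the closure in this norm of the span of the spherical waves $j_\ell(\kappa|\mathbf{x}|)Y_\ell^m(\mathbf{x}/|\mathbf{x}|)$, $|m|\le\ell$). Let $\Theta=[0,\pi]\times[0,2\pi)$. For $\boldsymbol{\theta}=(\theta_1,\theta_2)\in\Theta$, $\mathbf{d}(\boldsymbol{\theta})=(\sin\theta_1\cos\theta_2,\sin\theta_1\sin\theta_2,\cos\theta_1)\in\mathbb{S}^2$ and $\mathrm{PW}_{\boldsymbol{\theta}}(\mathbf{x})=e^{i\kappa\,\mathbf{d}(\boldsymbol{\theta})\cdot\mathbf{x}}$. $\sigma$ is the surface measure of $\mathbb{S}^2$, $d\sigma=\sin\theta_1\,d\theta_1\,d\theta_2$, and $L^2_\sigma(\Theta)$ is identified with $L^2(\mathbb{S}^2)$. A Bessel family in $\mathcal{B}$ over a $\sigma$-finite measure space $(X,\mu)$ is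 a set $\{\phi_x\}_{x\in X}\subset\mathcal{B}$ for which there is $B>0$ with $\int_X|(u,\phi_x)_{\mathcal{B}}|^2d\mu(x)\le B\|u\|_{\mathcal{B}}^2$ for all $u\in\mathcal{B}$; its synthesis operator is $\mathbf{T}_X:L^2_\mu(X)\to\mathcal{B}$, $\mathbf{T}_Xv=\int_Xv(x)\phi_x\,d\mu(x)$. It is a stable continuous approximation for $\mathcal{B}$ if for any $\eta>0$ there exists $C_{\mathrm{cs}}\ge0$ such that for every $u\in\mathcal{B}$ there is $v\in L^2_\mu(X)$ with $\|u-\mathbf{T}_Xv\|_{\mathcal{B}}\le\eta\|u\|_{\mathcal{B}}$ and $\|v\|_{L^2_\mu(X)}\le C_{\mathrm{cs}}\|u\|_{\mathcal{B}}$. *)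

(* Defs.v *)
From HB Require Import structures.
From mathcomp Require Import all_boot all_order all_algebra.
From mathcomp Require Import complex.
From mathcomp Require Import all_classical all_reals all_analysis.
From mathcomp Require Import measurable_realfun.

Set Implicit Arguments.
Unset Strict Implicit.
Unset Printing Implicit Defensive.

Import Order.TTheory GRing.Theory Num.Theory.
Import numFieldNormedType.Exports.

Local Open Scope classical_set_scope.
Local Open Scope ring_scope.

Local Notation normc := ComplexField.Normc.normc.

Section complex_integration.
Context {R : realType} {d : measure_display} {T : measurableType d}.

Definition Cmeasurable_fun (D : set T) (f : T -> R[i]) : Prop :=
  measurable_fun D (fun x => complex.Re (f x)) /\
  measurable_fun D (fun x => complex.Im (f x)).

Variables (mu : {measure set T -> \bar R}) (D : set T).

Definition Cintegral (f : T -> R[i]) : R[i] :=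
  Complex (\int[mu]_(x in D) complex.Re (f x))
          (\int[mu]_(x in D) complex.Im (f x)).

Definition L2 (f : T -> R[i]) : Prop :=
  Cmeasurable_fun D f /\
  (\int[mu]_(x in D) (normc (f x) ^+ 2)%:E < +oo)%E.

Definition L2norm (f : T -> R[i]) : R :=
  Num.sqrt (\int[mu]_(x in D) (normc (f x) ^+ 2)).

End complex_integration.

(* R^3 is R * R * R.  For integration it is read as the (convertible) type
   R3, which carries the product of the Borel sigma-algebras of R; for
   differentiation it is the normed module R * R * R, whose topology is the
   usual one. *)
Notation R3 R :=
  (measurableTypeR R * measurableTypeR R * measurableTypeR R)%type.

Section helmholtz_space.
Context {R : realType}.
Implicit Types (x y : R * R * R) (k : 'I_3).

Definition lebesgue3 : {measure set (R3 R) -> \bar R} :=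
  ((@lebesgue_measure R \x @lebesgue_measure R) \x @lebesgue_measure R)%E.

Definition coord3 k x : R := [:: x.1.1; x.1.2; x.2]`_k.

Definition basis3 k : R * R * R :=
  ((k == 0%N :> nat)%:R, (k == 1%N :> nat)%:R, (k == 2%N :> nat)%:R).

Definition dot x y : R := \sum_(k < 3) coord3 k x * coord3 k y.

Definition unit_ball : set (R3 R) := [set x | dot x x < 1].

Definition partial k (f : R * R * R -> R) : R * R * R -> R :=
  fun x => 'D_(basis3 k) f x.

Definition smooth (f : R * R * R -> R) : Prop :=
  forall (s : seq 'I_3) x, differentiable (foldr partial f s) x.

(* C_c^oo(B_1).  Real-valued test functions suffice: testing against a
   complex-valued one amounts to testing against its real and imaginary
   parts. *)
Definition test_function (phi : R * R * R -> R) : Prop :=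
  smooth phi /\
  exists K : set (R * R * R),
    [/\ compact K, K `<=` unit_ball & forall x, ~ K x -> phi x = 0].

(* An element of H^1(B_1) is represented by a function together with its weak
   gradient.  The gradient is determined by the function up to a null set, and
   the products and norms below only depend on classes modulo null sets. *)
Record jet := Jet { jval : R3 R -> R[i]; jgrad : 'I_3 -> R3 R -> R[i] }.

Definition jet_sub (u w : jet) : jet :=
  Jet (fun x => jval u x - jval w x) (fun k x => jgrad u k x - jgrad w k x).

Definition weak_partial k (u g : R3 R -> R[i]) : Prop :=
  forall phi, test_function phi ->
    Cintegral lebesgue3 unit_ball (fun x => u x * (partial k phi x)%:C%C) =
    - Cintegral lebesgue3 unit_ball (fun x => g x * (phi x)%:C%C).

Definition H1 (u : jet) : Prop :=
  [/\ L2 lebesgue3 unit_ball (jval u),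
      forall k, L2 lebesgue3 unit_ball (jgrad u k) &
      forall k, weak_partial k (jval u) (jgrad u k)].

Definition laplacian (phi : R * R * R -> R) : R * R * R -> R :=
  fun x => \sum_(k < 3) partial k (partial k phi) x.

(* u is in H^1(B_1) and solves the Helmholtz equation in the sense of
   distributions. *)
Definition helmholtz_space (kappa : R) (u : jet) : Prop :=
  H1 u /\
  forall phi, test_function phi ->
    Cintegral lebesgue3 unit_ball
      (fun x => jval u x * (laplacian phi x + kappa ^+ 2 * phi x)%:C%C) = 0.

Definition helmholtz_prod (kappa : R) (u w : jet) : R[i] :=
  Cintegral lebesgue3 unit_ball (fun x => jval u x * conjc (jval w x)) +
  (kappa ^- 2)%:C%C *
  Cintegral lebesgue3 unit_ball
    (fun x => \sum_(k < 3) jgrad u k x * conjc (jgrad w k x)).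

Definition helmholtz_norm (kappa : R) (u : jet) : R :=
  Num.sqrt (L2norm lebesgue3 unit_ball (jval u) ^+ 2 +
    kappa ^- 2 * \sum_(k < 3) L2norm lebesgue3 unit_ball (jgrad u k) ^+ 2).

End helmholtz_space.

Section continuous_approximation.
Context {R : realType} {d : measure_display} {T : measurableType d}.
Variables (kappa : R) (mu : {sigma_finite_measure set T -> \bar R}).
Variables (X : set T) (phi : T -> @jet R).

Definition bessel_family : Prop :=
  [/\ forall x, X x -> helmholtz_space kappa (phi x),
      forall u, helmholtz_space kappa u ->
        Cmeasurable_fun X (fun x => helmholtz_prod kappa u (phi x)) &
      exists B : R, 0 < B /\
        forall u, helmholtz_space kappa u ->
          (\int[mu]_(x in X) (normc (helmholtz_prod kappa u (phi x)) ^+ 2)%:E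
            <= (B * helmholtz_norm kappa u ^+ 2)%:E)%E].

(* w = T_X v, where the integral of v(x) phi_x over X is the usual weak
   (Pettis) integral in the Hilbert space. *)
Definition synthesis (v : T -> R[i]) (w : jet) : Prop :=
  helmholtz_space kappa w /\
  forall u, helmholtz_space kappa u ->
    helmholtz_prod kappa w u =
    Cintegral mu X (fun x => v x * helmholtz_prod kappa (phi x) u).

Definition stable_continuous_approximation : Prop :=
  forall eta : R, 0 < eta ->
    exists Ccs : R, 0 <= Ccs /\
      forall u, helmholtz_space kappa u ->
        exists v : T -> R[i], exists w : jet,
          [/\ L2 mu X v,
              synthesis v w,
              helmholtz_norm kappa (jet_sub u w) <=
                eta * helmholtz_norm kappa u &
              L2norm mu X v <= Ccs * helmholtz_norm kappa u].

End continuous_approximation.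

Section plane_waves.
Context {R : realType}.

Local Notation R2 := (measurableTypeR R * measurableTypeR R)%type.
Local Notation lebesgue2 := (@lebesgue_measure R \x @lebesgue_measure R)%E.

Definition Theta : set R2 := `[0, pi] `*` `[0, 2 * pi[.

(* The surface measure of the sphere in spherical coordinates, as a measure on
   R^2 concentrated on Theta. *)
Definition sphere_measure (A : set R2) : \bar R :=
  (\int[lebesgue2]_(theta in A `&` Theta) (sin theta.1)%:E)%E.

Let mTheta : measurable Theta.
Proof. by apply: measurableX; exact: measurable_itv. Qed.

Let sin_ge0 (theta : R2) : Theta theta -> (0 <= (sin theta.1)%:E :> \bar R)%E.
Proof.
by move=> [t1 _]; rewrite lee_fin; exact: sin_ge0_pi t1.
Qed.

Let msin (D : set R2) : measurable_fun D (EFin \o (fun theta : R2 => sin theta.1)).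
Proof.
apply: measurable_funTS; apply/measurable_EFinP.
apply: (measurableT_comp (f := sin)) => //.
by apply: continuous_measurable_fun; exact: continuous_sin.
Qed.

Let sphere0 : sphere_measure set0 = 0%E.
Proof. by rewrite /sphere_measure set0I integral_set0. Qed.

Let sphere_ge0 A : (0 <= sphere_measure A)%E.
Proof. by apply: integral_ge0 => x [_ /sin_ge0]. Qed.

Let sphere_sigma_additive : semi_sigma_additive sphere_measure.
Proof.
move=> F mF tF mUF; rewrite /sphere_measure; apply: cvg_toP.
  apply: ereal_nondecreasing_is_cvgn => m n mn.
  by apply: lee_sum_nneg_natr => // k _ _; exact: sphere_ge0.
rewrite setI_bigcupl ge0_integral_bigcup//=.
- by move=> k; exact: measurableI.
- by move=> x [k _ [_ /sin_ge0]].
- by apply: trivIset_setIr.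
Qed.

HB.instance Definition _ := isMeasure.Build _ _ _
  sphere_measure sphere0 sphere_ge0 sphere_sigma_additive.

Let sphere_fin : fin_num_fun sphere_measure.
Proof.
move=> A mA; rewrite ge0_fin_numE ?sphere_ge0//.
rewrite /sphere_measure.
apply: (@le_lt_trans _ _ (\int[lebesgue2]_(theta in Theta) (cst 1%:E theta))%E).
  apply: (@le_trans _ _ (\int[lebesgue2]_(theta in Theta) (sin theta.1)%:E)%E).
    apply: ge0_subset_integral => //.
    exact: measurableI.
  apply: ge0_le_integral => //.
  by move=> x _; rewrite lee_fin sin_le1.
rewrite integral_cst// mul1e.
rewrite [ltLHS](product_measure1E lebesgue_measure lebesgue_measure (measurable_itv `[0%R, pi]) (measurable_itv `[0%R, 2 * pi[)).
by rewrite /= !lebesgue_measure_itv/=; do 2 case: ifP => _; rewrite ?mule0 ?mul0e ?ltry.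
Qed.

HB.instance Definition _ := @Measure_isFinite.Build _ _ _
  sphere_measure sphere_fin.

Definition direction (theta : R2) : R * R * R :=
  (sin theta.1 * cos theta.2, sin theta.1 * sin theta.2, cos theta.1).

Definition expi (t : R) : R[i] := Complex (cos t) (sin t).

(* The second component is the classical gradient. *)
Definition plane_wave (kappa : R) (theta : R2) : jet :=
  Jet (fun x => expi (kappa * dot (direction theta) x))
      (fun k x => Complex 0 (kappa * coord3 k (direction theta)) *
                  expi (kappa * dot (direction theta) x)).

End plane_waves.

(* Main.v *)
(* If e_1, ..., e_N is an orthonormal family of B, Bessel's inequality applied
   to each plane wave gives
     sum_i int_Theta |(e_i, PW_theta)|^2 d sigma <= int_Theta |PW_theta|^2 d sigma,
   and the right-hand side is a finite constant M.  On the other hand, when e_i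
   is approximated within 1/2 by T v with |v| <= C, one has |(T v, e_i)| >= 1/2,
   and (T v, e_i) is the integral of v(theta) (PW_theta, e_i), so by the
   Cauchy-Schwarz inequality int_Theta |(e_i, PW_theta)|^2 >= 1 / (4 C^2).
   Hence N <= 4 C^2 M, which is impossible for large N because B has infinite
   dimension: plane waves in distinct directions are linearly independent. *)

Require Import Defs.
From HB Require Import structures.
From mathcomp Require Import all_boot all_order all_algebra.
From mathcomp Require Import complex.
From mathcomp Require Import all_classical all_reals all_analysis.
From mathcomp Require Import measurable_realfun.
From mathcomp Require Import ring lra.

Set Implicit Arguments.
Unset Strict Implicit.
Unset Printing Implicit Defensive.

Import Order.TTheory GRing.Theory Num.Theory.
Import numFieldNormedType.Exports.

Local Open Scope classical_set_scope.
Local Open Scope ring_scope.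

Local Notation normc := ComplexField.Normc.normc.
Local Notation Re := complex.Re.
Local Notation Im := complex.Im.

(** The contradiction needs only that M does not depend on N; here M is 2 |B_1| sigma(Theta),
    because every plane wave has squared norm exactly 2 |B_1|, whatever its direction. No spherical
    wave or decay estimate enters. Two obstacles shape the development. First, elements of B are
    represented by jets, and a jet that vanishes almost everywhere has norm zero, so the product is
    only semidefinite. Cauchy-Schwarz and Bessel are therefore proved for semidefinite forms, and
    the vector that extends an orthonormal family gets its positive norm from continuity: it is
    nonzero at some point of the ball. Second, B is defined by weak conditions, so placing plane
    waves in it requires integration by parts against test functions. These vanish outside the open
    ball, hence no boundary term appears and everything reduces to the fundamental theorem of
    calculus along lines parallel to the axes. Infinite dimension is used one N at a time, so the
    directions of the waves may be chosen depending on N. *)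

Section complex_parts.
Context {R : realType}.
Implicit Types x y : R[i].

Lemma cReD x y : Re (x + y) = Re x + Re y. Proof. by case: x y => ? ? []. Qed.
Lemma cImD x y : Im (x + y) = Im x + Im y. Proof. by case: x y => ? ? []. Qed.
Lemma cReN x : Re (- x) = - Re x. Proof. by case: x. Qed.
Lemma cImN x : Im (- x) = - Im x. Proof. by case: x. Qed.
Lemma cReM x y : Re (x * y) = Re x * Re y - Im x * Im y.
Proof. by case: x y => ? ? []. Qed.
Lemma cImM x y : Im (x * y) = Re x * Im y + Im x * Re y.
Proof. by case: x y => ? ? []. Qed.
Lemma cRe_conj x : Re (conjc x) = Re x. Proof. by case: x. Qed.
Lemma cIm_conj x : Im (conjc x) = - Im x. Proof. by case: x. Qed.
Lemma cReC (t : R) : Re t%:C%C = t. Proof. by []. Qed.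
Lemma cImC (t : R) : Im t%:C%C = 0. Proof. by []. Qed.

Definition ReImE := (cReD, cImD, cReN, cImN, cReM, cImM, cRe_conj, cIm_conj).

Lemma cRe_sum (n : nat) (z : 'I_n -> R[i]) :
  Re (\sum_(k < n) z k) = \sum_(k < n) Re (z k).
Proof. exact: (big_morph _ cReD (erefl (Re 0))). Qed.

Lemma cIm_sum (n : nat) (z : 'I_n -> R[i]) :
  Im (\sum_(k < n) z k) = \sum_(k < n) Im (z k).
Proof. exact: (big_morph _ cImD (erefl (Im 0))). Qed.

Lemma complex_ext x y : Re x = Re y -> Im x = Im y -> x = y.
Proof. by case: x y => ? ? [] ? ? /= -> ->. Qed.

Lemma normc_nneg x : 0 <= normc x.
Proof. by case: x => a b; exact: sqrtr_ge0. Qed.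

Lemma normc_sqr x : normc x ^+ 2 = Re x ^+ 2 + Im x ^+ 2.
Proof. by case: x => a b; rewrite /= sqr_sqrtr// addr_ge0// sqr_ge0. Qed.

End complex_parts.

(** * Semidefinite Hermitian forms *)

(* [axpy a u w] stands for a u + w, where only elements satisfying P have
   finite norm. *)
Section semidefinite_hermitian_form.
Context {R : realType} {V : Type} (P : V -> Prop).
Context (axpy : R[i] -> V -> V -> V) (form : V -> V -> R[i]).
Hypothesis axpyP : forall a u w, P u -> P w -> P (axpy a u w).
Hypothesis form_axpy : forall a u w z, P u -> P w -> P z ->
  form (axpy a u w) z = a * form u z + form w z.
Hypothesis formC : forall u w, P u -> P w -> form w u = conjc (form u w).
Hypothesis form_ge0 : forall u, P u -> 0 <= Re (form u u).

Lemma form_axpy_axpy a u w : P u -> P w ->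
  Re (form (axpy a u w) (axpy a u w)) =
  normc a ^+ 2 * Re (form u u) + 2 * Re (a * form u w) + Re (form w w).
Proof.
move=> Pu Pw; have Pa := axpyP a Pu Pw.
rewrite form_axpy// (formC Pa Pu) (formC Pa Pw) !form_axpy//.
have := formC Pu Pu; have := formC Pw Pw; rewrite (formC Pu Pw) => ww uu.
have := congr1 (@complex.Im R) uu; have := congr1 (@complex.Im R) ww.
rewrite !ReImE normc_sqr => iw iu.
have -> : Im (form u u) = 0 by lra.
ring.
Qed.

(** The form is nonnegative at [t * conjc (form u w)] times [u] plus [w], for every real t; the
    conjugate makes the cross term real. This gives a polynomial in t of degree at most 2, to be
    tested at one well-chosen t. Semidefiniteness forces a separate case [p = 0]. *)
Lemma form_Cauchy_Schwarz u w : P u -> P w ->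
  normc (form u w) ^+ 2 <= Re (form u u) * Re (form w w).
Proof.
move=> Pu Pw; set m := normc _ ^+ 2; set p := Re _; set q := Re _.
have m0 : 0 <= m by rewrite sqr_ge0.
have H t : 0 <= t ^+ 2 * m * p + 2 * t * m + q.
  have := form_ge0 (axpyP (t%:C%C * conjc (form u w)) Pu Pw).
  rewrite form_axpy_axpy// => /le_trans; apply.
  rewrite -/p -/q /m !normc_sqr !ReImE !cReC !cImC le_eqVlt; apply/orP; left; apply/eqP.
  ring.
have : 0 <= p by exact: form_ge0.
rewrite le_eqVlt => /orP[/eqP p0|p0].
  rewrite -p0 mul0r.
  have [m1|//] := ltP 0 m.
  (* With [p = 0] the polynomial is affine of slope 2m; at this t its value is -1. *)
  have := H (- (q + 1) / (2 * m)); rewrite -p0 mulr0 add0r.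
  have -> : 2 * (- (q + 1) / (2 * m)) * m = - (q + 1) by field; lra.
  lra.
(* The minimiser of the quadratic polynomial. *)
have := H (- p^-1).
have -> : (- p^-1) ^+ 2 * m * p + 2 * - p^-1 * m + q = q - m / p.
  field; lra.
by rewrite subr_ge0 ler_pdivrMr// [q * p]mulrC.
Qed.

(** The residual [r k] is f minus its components along the first k vectors. Each subtraction leaves
    the products with the later vectors unchanged and lowers the squared norm by one term of the
    sum; the last residual still has nonnegative squared norm. *)
Lemma form_Bessel (e : nat -> V) (N : nat) f : P f ->
  (forall i, (i < N)%N -> P (e i)) ->
  (forall i j, (i < N)%N -> (j < N)%N -> form (e i) (e j) = (i == j)%:R) ->
  \sum_(i < N) normc (form f (e i)) ^+ 2 <= Re (form f f).
Proof.
move=> Pf Pe ee.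
pose fix r k := if k is k'.+1 then axpy (- form f (e k')) (e k') (r k') else f.
suff H k : (k <= N)%N -> [/\ P (r k),
    forall j, (k <= j < N)%N -> form (r k) (e j) = form f (e j) &
    Re (form (r k) (r k)) = Re (form f f) - \sum_(i < k) normc (form f (e i)) ^+ 2].
  by have [Pr _] := H N (leqnn N); have := form_ge0 Pr => /[swap] ->; rewrite subr_ge0.
elim: k => [|k IH] kN; first by rewrite big_ord0 subr0.
have [Pr rj rr] := IH (ltnW kN); have Pk := Pe _ kN; split => /=.
- exact: axpyP.
- move=> j /andP[kj jN]; rewrite form_axpy ?ee ?rj//; last 2 first.
    by rewrite (ltnW kj).
    exact: Pe.
  by rewrite (ltn_eqF kj) mulr0 add0r.
- rewrite form_axpy_axpy// big_ord_recr/= rr ee// eqxx (formC Pr Pk) rj; last first.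
    by rewrite leqnn.
  rewrite !normc_sqr !ReImE /=; ring.
Qed.

End semidefinite_hermitian_form.
(** * Square integrable complex functions *)

Section square_integrable.
Context {R : realType} {d : measure_display} {T : measurableType d}.
Variables (mu : {measure set T -> \bar R}) (D : set T).
Hypothesis mD : measurable D.
Local Notation intble f := (mu.-integrable D (EFin \o f)).

Definition sqint (f : T -> R) : Prop :=
  measurable_fun D f /\ intble (fun x => f x ^+ 2).

Lemma integrableD_EFin (f g : T -> R) :
  intble f -> intble g -> intble (fun x => f x + g x).
Proof. by move=> /(integrableD mD) /[apply]. Qed.

Lemma integrableZ_EFin (a : R) (f : T -> R) :
  intble f -> intble (fun x => a * f x).
Proof. exact: integrableZl. Qed.

Lemma integrableB_EFin (f g : T -> R) :
  intble f -> intble g -> intble (fun x => f x - g x).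
Proof. by move=> /(integrableB mD) /[apply]. Qed.

Lemma integrable_sum_EFin (n : nat) (f : 'I_n -> T -> R) :
  (forall i, intble (f i)) -> intble (fun x => \sum_(i < n) f i x).
Proof.
elim: n f => [|n IH] f fi.
  by under eq_fun do rewrite big_ord0; exact: integrable0.
by under eq_fun do rewrite big_ord_recl; apply: integrableD_EFin => //; exact: IH.
Qed.

Lemma Rintegral_sum (n : nat) (f : 'I_n -> T -> R) : (forall i, intble (f i)) ->
  \int[mu]_(x in D) (\sum_(i < n) f i x) = \sum_(i < n) \int[mu]_(x in D) f i x.
Proof.
elim: n f => [|n IH] f fi.
  by rewrite big_ord0; under eq_Rintegral do rewrite big_ord0; rewrite Rintegral_cst// mul0r.
rewrite big_ord_recl -IH// -RintegralD//; last exact: integrable_sum_EFin.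
by apply: eq_Rintegral => x _; rewrite big_ord_recl.
Qed.

(** The squares of f + g and f - g are nonnegative, so |fg| is dominated by f^2 + g^2. *)
Lemma sqint_mul f g : sqint f -> sqint g -> intble (fun x => f x * g x).
Proof.
move=> [mf iff] [mg igg].
apply: le_integrable (integrableD_EFin iff igg) => //.
  by apply/measurable_EFinP; exact: measurable_funM.
move=> x _ /=; rewrite lee_fin [leRHS]ger0_norm ?addr_ge0 ?sqr_ge0//.
have := sqr_ge0 (f x - g x); have := sqr_ge0 (f x + g x).
rewrite ler_norml => h1 h2; apply/andP; split; nra.
Qed.

Lemma sqintD f g : sqint f -> sqint g -> sqint (fun x => f x + g x).
Proof.
move=> hf hg; have fg := sqint_mul hf hg; move: hf hg => [mf iff] [mg igg].
split; first exact: measurable_funD.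
under eq_fun do rewrite sqrrD -mulr_natl.
by do ![exact: integrableZ_EFin | apply: integrableD_EFin].
Qed.

Lemma sqintZ a f : sqint f -> sqint (fun x => a * f x).
Proof.
move=> [mf iff]; split; first exact: measurable_funM.
by under eq_fun do rewrite exprMn; exact: integrableZ_EFin.
Qed.

Lemma sqintB f g : sqint f -> sqint g -> sqint (fun x => f x - g x).
Proof.
move=> hf hg; under eq_fun do rewrite -[- g _]mulN1r.
by apply: sqintD => //; exact: sqintZ.
Qed.

Lemma sqint_bounded (f : T -> R) (M : R) : (mu D < +oo)%E ->
  measurable_fun D f -> (forall x, D x -> `|f x| <= M) -> sqint f.
Proof.
move=> Dfin mf fM; split => //.
apply: (@le_integrable _ _ _ mu D mD _ (cst (M ^+ 2)%:E)).
- by apply/measurable_EFinP; exact: measurable_funX.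
- move=> x Dx /=; rewrite lee_fin !ger0_norm ?sqr_ge0//.
  by rewrite -real_normK ?num_real// lerXn2r ?nnegrE// ?(le_trans _ (fM _ Dx)) ?fM.
- apply/integrableP; split => //=; rewrite integral_cst//=.
  by rewrite lte_mul_pinfty.
Qed.

Lemma L2P (f : T -> R[i]) :
  L2 mu D f <-> sqint (fun x => Re (f x)) /\ sqint (fun x => Im (f x)).
Proof.
split=> [[[mr mi] f2]|[[mr ir] [mi ii]]].
  have i2 : intble (fun x => normc (f x) ^+ 2).
    apply/integrableP; split.
      apply/measurable_EFinP; under eq_fun do rewrite normc_sqr.
      by apply: measurable_funD; exact: measurable_funX.
    by under eq_integral do rewrite /= ger0_norm ?sqr_ge0//.
  split; split => //; apply: le_integrable i2 => //;
    try (by apply/measurable_EFinP; exact: measurable_funX);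
    move=> x _ /=; rewrite lee_fin !ger0_norm ?sqr_ge0// normc_sqr.
    by rewrite lerDl sqr_ge0.
  by rewrite lerDr sqr_ge0.
split => //.
have /integrableP[_] := integrableD_EFin ir ii.
by under eq_integral do rewrite /= -normc_sqr ger0_norm ?sqr_ge0//.
Qed.

Definition Cintegrable (f : T -> R[i]) : Prop :=
  intble (fun x => Re (f x)) /\ intble (fun x => Im (f x)).

Lemma CintegralD f g : Cintegrable f -> Cintegrable g ->
  Cintegral mu D (fun x => f x + g x) = Cintegral mu D f + Cintegral mu D g.
Proof.
move=> [fr fi] [gr gi]; apply: complex_ext; rewrite ReImE /= -RintegralD//;
by apply: eq_Rintegral => x _; rewrite ReImE.
Qed.

Lemma CintegralZ a f : Cintegrable f ->
  Cintegral mu D (fun x => a * f x) = a * Cintegral mu D f.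
Proof.
move=> [fr fi]; apply: complex_ext; rewrite ReImE /= -!RintegralZl//.
  rewrite -RintegralB//; try exact: integrableZ_EFin.
  by apply: eq_Rintegral => x _; rewrite ReImE.
rewrite -RintegralD//; try exact: integrableZ_EFin.
by apply: eq_Rintegral => x _; rewrite ReImE.
Qed.

Lemma Cintegral_conj f : Cintegrable f ->
  Cintegral mu D (fun x => conjc (f x)) = conjc (Cintegral mu D f).
Proof.
move=> [fr fi]; apply: complex_ext; rewrite ReImE /=.
  by apply: eq_Rintegral => x _; rewrite ReImE.
rewrite -[RHS]mulN1r -RintegralZl//.
by apply: eq_Rintegral => x _; rewrite ReImE mulN1r.
Qed.

Lemma CintegrableZ a f : Cintegrable f -> Cintegrable (fun x => a * f x).
Proof.
by move=> [fr fi]; split; under eq_fun do rewrite ReImE;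
  [apply: integrableB_EFin|apply: integrableD_EFin]; exact: integrableZ_EFin.
Qed.

Lemma Cintegrable_sum (n : nat) (f : 'I_n -> T -> R[i]) :
  (forall k, Cintegrable (f k)) -> Cintegrable (fun x => \sum_(k < n) f k x).
Proof.
move=> fi; split.
  by under eq_fun do rewrite cRe_sum; apply: integrable_sum_EFin => k; case: (fi k).
by under eq_fun do rewrite cIm_sum; apply: integrable_sum_EFin => k; case: (fi k).
Qed.

Lemma Cintegral_sum (n : nat) (f : 'I_n -> T -> R[i]) :
  (forall k, Cintegrable (f k)) ->
  Cintegral mu D (fun x => \sum_(k < n) f k x) =
  \sum_(k < n) Cintegral mu D (f k).
Proof.
move=> fi; apply: complex_ext; rewrite ?cRe_sum ?cIm_sum /= -Rintegral_sum.
- by apply: eq_Rintegral => x _; rewrite cRe_sum.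
- by move=> k; case: (fi k).
- by apply: eq_Rintegral => x _; rewrite cIm_sum.
- by move=> k; case: (fi k).
Qed.

Lemma L2_mulC_integrable f g : L2 mu D f -> L2 mu D g ->
  Cintegrable (fun x => f x * conjc (g x)).
Proof.
move=> /L2P[fr fi] /L2P[gr gi]; split; under eq_fun do rewrite !ReImE.
  by under eq_fun do rewrite mulrN opprK; apply: integrableD_EFin; exact: sqint_mul.
under eq_fun do rewrite mulrN addrC.
by apply: integrableB_EFin; exact: sqint_mul.
Qed.

Lemma L2_axpy a f g : L2 mu D f -> L2 mu D g ->
  L2 mu D (fun x => a * f x + g x).
Proof.
move=> /L2P[fr fi] /L2P[gr gi]; apply/L2P; split;
under eq_fun do rewrite !ReImE; apply: sqintD => //.
  by apply: sqintB; exact: sqintZ.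
by apply: sqintD; exact: sqintZ.
Qed.

Lemma Re_Cintegral_self f :
  Re (Cintegral mu D (fun x => f x * conjc (f x))) = L2norm mu D f ^+ 2.
Proof.
rewrite /L2norm sqr_sqrtr; last by apply: Rintegral_ge0 => x _; exact: sqr_ge0.
by apply: eq_Rintegral => x _; rewrite normc_sqr !ReImE; ring.
Qed.

Lemma L2_Cauchy_Schwarz f g : L2 mu D f -> L2 mu D g ->
  normc (Cintegral mu D (fun x => f x * conjc (g x))) ^+ 2 <=
  L2norm mu D f ^+ 2 * L2norm mu D g ^+ 2.
Proof.
move=> f2 g2; rewrite -!Re_Cintegral_self.
apply: (form_Cauchy_Schwarz (P := L2 mu D)
  (axpy := fun a u w x => a * u x + w x)
  (form := fun u w => Cintegral mu D (fun x => u x * conjc (w x)))) => //.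
- exact: L2_axpy.
- move=> a u w z u2 w2 z2; rewrite -CintegralZ; last exact: L2_mulC_integrable.
  rewrite -CintegralD; last 2 first.
    exact/CintegrableZ/L2_mulC_integrable.
    exact: L2_mulC_integrable.
  by congr Cintegral; apply/funext => x; rewrite mulrDl mulrA.
- move=> u w u2 w2; rewrite -Cintegral_conj; last exact: L2_mulC_integrable.
  by congr Cintegral; apply/funext => x; rewrite rmorphM /= conjcK mulrC.
- by move=> u u2; rewrite Re_Cintegral_self sqr_ge0.
Qed.

End square_integrable.

(** * The Helmholtz product *)

Section jets.
Context {R : realType}.
Implicit Types (kappa : R) (u w z : @jet R).
Local Notation lebesgue := (@lebesgue_measure R).
Local Notation B1 := (@unit_ball R).

Lemma dotE (x y : R * R * R) :
  dot x y = x.1.1 * y.1.1 + x.1.2 * y.1.2 + x.2 * y.2.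
Proof. by rewrite /dot !big_ord_recl big_ord0 /coord3 /= addr0 addrA. Qed.

Lemma lebesgue3_box (A B C : set (measurableTypeR R)) :
  measurable A -> measurable B -> measurable C ->
  @lebesgue3 R (A `*` B `*` C) = (lebesgue A * lebesgue B * lebesgue C)%E.
Proof.
move=> mA mB mC; rewrite [LHS]product_measure1E//; last exact: measurableX.
by congr (_ * _)%E; rewrite [LHS]product_measure1E.
Qed.

Lemma measurable_coord3 k : measurable_fun setT (coord3 k : R3 R -> R).
Proof.
case: k => [[|[|[|//]]]] i; rewrite /coord3 /=.
- exact: (measurableT_comp measurable_fst measurable_fst).
- exact: (measurableT_comp measurable_snd measurable_fst).
- exact: measurable_snd.
Qed.

Lemma measurable_unit_ball : measurable B1.
Proof.
rewrite -[B1]setTI.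
have mf : measurable_fun setT (fun x : R3 R => dot x x).
  by apply: measurable_sum => k; apply: measurable_funM; exact: measurable_coord3.
have -> : B1 = (fun x : R3 R => dot x x) @^-1` `]-oo, 1[.
  by apply/seteqP; split => x /=; rewrite in_itv.
exact: mf.
Qed.

Lemma unit_ball_subset : B1 `<=` `[-1, 1] `*` `[-1, 1] `*` `[-1, 1].
Proof.
move=> [[a b] c]; rewrite /unit_ball /= dotE /= !in_itv/= => h.
have := sqr_ge0 a; have := sqr_ge0 b; have := sqr_ge0 c; rewrite !expr2 => *.
do ?split => /=; rewrite -ler_norml -(@ler_pXn2r _ 2)// ?nnegrE//
  expr1n real_normK ?num_real// expr2; lra.
Qed.

Lemma unit_ball_lty : (@lebesgue3 R B1 < +oo)%E.
Proof.
apply: (@le_lt_trans _ _ (@lebesgue3 R (`[-1, 1] `*` `[-1, 1] `*` `[-1, 1]))).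
  apply: le_measure; rewrite ?inE; first exact: measurable_unit_ball.
    by apply: measurableX; [apply: measurableX|]; exact: measurable_itv.
  exact: unit_ball_subset.
rewrite lebesgue3_box// lebesgue_measure_itv/=; case: ifP => _.
  by rewrite -!EFinB -!EFinM ltry.
by rewrite !mule0 ltry.
Qed.

(** The domain on which the Helmholtz product is a semidefinite Hermitian form: the form laws use
    square integrability alone, so this is the predicate given to the abstract lemmas. *)
Definition jet_L2 u : Prop :=
  L2 lebesgue3 B1 (jval u) /\ forall k, L2 lebesgue3 B1 (jgrad u k).

Definition jet_axpy (a : R[i]) u w : jet :=
  Jet (fun x => a * jval u x + jval w x)
      (fun k x => a * jgrad u k x + jgrad w k x).

Lemma jet_subE u w : jet_sub u w = jet_axpy (-1) w u.
Proof.
rewrite /jet_sub /jet_axpy; congr Jet.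
  by apply/funext => x; rewrite mulN1r addrC.
by apply/funext => k; apply/funext => x; rewrite mulN1r addrC.
Qed.

Lemma helmholtz_space_L2 kappa u : helmholtz_space kappa u -> jet_L2 u.
Proof. by case=> -[]. Qed.

Lemma jet_axpy_L2 a u w : jet_L2 u -> jet_L2 w -> jet_L2 (jet_axpy a u w).
Proof.
move=> [u0 u1] [w0 w1]; split => [|k]; apply: L2_axpy => //;
exact: measurable_unit_ball.
Qed.

Lemma helmholtz_prodE kappa u w : jet_L2 u -> jet_L2 w ->
  helmholtz_prod kappa u w =
  Cintegral lebesgue3 B1 (fun x => jval u x * conjc (jval w x)) +
  (kappa ^- 2)%:C%C * \sum_(k < 3)
  Cintegral lebesgue3 B1 (fun x => jgrad u k x * conjc (jgrad w k x)).
Proof.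
move=> [_ u1] [_ w1]; rewrite -Cintegral_sum//; first exact: measurable_unit_ball.
by move=> k; apply: L2_mulC_integrable => //; exact: measurable_unit_ball.
Qed.

Lemma L2prod_axpy (a : R[i]) (f g h : R3 R -> R[i]) :
  L2 lebesgue3 B1 f -> L2 lebesgue3 B1 g -> L2 lebesgue3 B1 h ->
  Cintegral lebesgue3 B1 (fun x => (a * f x + g x) * conjc (h x)) =
  a * Cintegral lebesgue3 B1 (fun x => f x * conjc (h x)) +
  Cintegral lebesgue3 B1 (fun x => g x * conjc (h x)).
Proof.
have mB := measurable_unit_ball => f2 g2 h2.
rewrite -CintegralZ//; last exact: L2_mulC_integrable.
rewrite -CintegralD//; last 2 first.
  exact/CintegrableZ/L2_mulC_integrable.
  exact: L2_mulC_integrable.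
by congr Cintegral; apply/funext => x; rewrite mulrDl mulrA.
Qed.

Lemma helmholtz_prod_axpy kappa a u w z : jet_L2 u -> jet_L2 w -> jet_L2 z ->
  helmholtz_prod kappa (jet_axpy a u w) z =
  a * helmholtz_prod kappa u z + helmholtz_prod kappa w z.
Proof.
move=> u2 w2 z2; rewrite !helmholtz_prodE//; last exact: jet_axpy_L2.
case: u2 w2 z2 => [u0 u1] [w0 w1] [z0 z1].
under eq_bigr do rewrite L2prod_axpy//.
rewrite L2prod_axpy// big_split/= -mulr_sumr; ring.
Qed.

Lemma helmholtz_prodC kappa u w : jet_L2 u -> jet_L2 w ->
  helmholtz_prod kappa w u = conjc (helmholtz_prod kappa u w).
Proof.
have mB := measurable_unit_ball => u2 w2; rewrite !helmholtz_prodE//.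
case: u2 w2 => [u0 u1] [w0 w1].
have cD (x y : R[i]) : conjc (x + y) = conjc x + conjc y by rewrite rmorphD.
have cM (x y : R[i]) : conjc (x * y) = conjc x * conjc y by rewrite rmorphM.
rewrite cD cM (big_morph _ cD (conjc0 R)).
rewrite -Cintegral_conj//; last exact: L2_mulC_integrable.
congr (_ + _ * _).
- by congr Cintegral; apply/funext => x; rewrite cM conjcK mulrC.
- by rewrite conjc_real.
- apply: eq_bigr => k _; rewrite -Cintegral_conj//; last exact: L2_mulC_integrable.
  by congr Cintegral; apply/funext => x; rewrite cM conjcK mulrC.
Qed.

Lemma helmholtz_prod_self kappa u : jet_L2 u ->
  Re (helmholtz_prod kappa u u) = helmholtz_norm kappa u ^+ 2.
Proof.
move=> u2; rewrite sqr_sqrtr; last first.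
  apply: addr_ge0; first exact: sqr_ge0.
  by apply: mulr_ge0; [rewrite invr_ge0 sqr_ge0|apply: sumr_ge0 => k _; exact: sqr_ge0].
rewrite helmholtz_prodE// !ReImE Re_Cintegral_self cReC cImC mul0r subr0.
congr (_ + _ * _).
by rewrite cRe_sum; apply: eq_bigr => k _; exact: Re_Cintegral_self.
Qed.

Lemma helmholtz_Cauchy_Schwarz kappa u w : jet_L2 u -> jet_L2 w ->
  normc (helmholtz_prod kappa u w) <= helmholtz_norm kappa u * helmholtz_norm kappa w.
Proof.
move=> u2 w2; rewrite -ler_sqr ?nnegrE ?mulr_ge0 ?sqrtr_ge0 ?normc_nneg//.
rewrite exprMn -!helmholtz_prod_self//.
apply: (form_Cauchy_Schwarz (P := jet_L2) (axpy := jet_axpy)) => //.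
- exact: jet_axpy_L2.
- by move=> *; exact: helmholtz_prod_axpy.
- by move=> *; exact: helmholtz_prodC.
- by move=> v v2; rewrite helmholtz_prod_self// sqr_ge0.
Qed.

Lemma helmholtz_Bessel kappa (e : nat -> jet) (N : nat) u : jet_L2 u ->
  (forall i, (i < N)%N -> jet_L2 (e i)) ->
  (forall i j, (i < N)%N -> (j < N)%N ->
    helmholtz_prod kappa (e i) (e j) = (i == j)%:R) ->
  \sum_(i < N) normc (helmholtz_prod kappa u (e i)) ^+ 2 <=
  helmholtz_norm kappa u ^+ 2.
Proof.
move=> u2 e2 ee; rewrite -helmholtz_prod_self//.
apply: (form_Bessel (P := jet_L2) (axpy := jet_axpy)) => //.
- exact: jet_axpy_L2.
- by move=> *; exact: helmholtz_prod_axpy.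
- by move=> *; exact: helmholtz_prodC.
- by move=> v v2; rewrite helmholtz_prod_self// sqr_ge0.
Qed.

End jets.

(** * Continuous functions on R^3: measurability and integrability over the ball *)

Section continuous_functions_on_space.
Context {R : realType}.
Local Notation B1 := (@unit_ball R).
Local Notation cube := (`[-1, 1] `*` `[-1, 1] `*` `[-1, 1] : set (R * R * R)).

(** Links the topology to the product sigma-algebra: an open set is the countable union of the boxes
    with rational centre and radius 1/(n+1) that it contains. *)
Lemma open_measurable_R3 (U : set (R * R * R)) : open U ->
  measurable (U : set (R3 R)).
Proof.
move=> oU; pose box p q r n : set (R3 R) :=
  ball (ratr p : R) n.+1%:R^-1 `*` ball (ratr q : R) n.+1%:R^-1 `*`
  ball (ratr r : R) n.+1%:R^-1.
(* A box that is not contained in [U] contributes the empty set, so the union can run over all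
   indices. *)
pose G p q r n := [set x | box p q r n x /\ box p q r n `<=` U].
have -> : U = \bigcup_p \bigcup_q \bigcup_r \bigcup_n G p q r n.
  apply/seteqP; split => [x Ux|x [p _] [q _] [r _] [n _] [? ]]; last exact.
  have /nbhs_ballP[e /= e0 eU] : nbhs x U by exact: open_nbhs_nbhs.
  (* Two points of a box of this radius are less than e apart in each coordinate, so a box
     containing x stays inside [U]. *)
  have [n ne] : exists n, n.+1%:R^-1 < e / 2 :> R.
    have e20 : 0 < e / 2 by rewrite divr_gt0.
    have [n _ /(_ n (leqnn n)) hn] := near_infty_natSinv_lt (PosNum e20).
    by exists n.
  have rat_near (r a : R) : 0 < r -> exists q : rat, ball (ratr q : R) r a.
    move=> r0; have ar : a - r < a + r by lra.
    have [q] := rat_in_itvoo ar.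
    rewrite in_itv/= => /andP[h1 h2]; exists q; rewrite -ball_normE /=.
    by rewrite ltr_norml; apply/andP; split; lra.
  have n0 : (0 : R) < n.+1%:R^-1 by rewrite invr_gt0.
  have [p hp] := rat_near _ x.1.1 n0; have [q hq] := rat_near _ x.1.2 n0.
  have [r hr] := rat_near _ x.2 n0.
  exists p => //; exists q => //; exists r => //; exists n => //; split => //.
  move=> y [[py qy] ry]; apply: eU.
  have tri (s : rat) (a b : R) : ball (ratr s : R) n.+1%:R^-1 a ->
      ball (ratr s : R) n.+1%:R^-1 b -> ball a e b.
    move=> sa sb; rewrite [e]splitr; apply: (@ball_triangle R R (ratr s)).
      by apply: ball_sym; apply: le_ball sa; exact: ltW.
    by apply: le_ball sb; exact: ltW.
  by split; [split|]; [exact: tri hp _|exact: tri hq _|exact: tri hr _].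
apply: bigcupT_measurable_rat => p; apply: bigcupT_measurable_rat => q.
apply: bigcupT_measurable_rat => r; apply: bigcupT_measurable => n.
have [bU|nbU] := pselect (box p q r n `<=` U).
  have -> : G p q r n = box p q r n by apply/seteqP; split=> [x []|x].
  by apply: measurableX; [apply: measurableX|]; exact: measurable_ball.
by have -> : G p q r n = set0 by apply/seteqP; split=> [x []|].
Qed.

Lemma continuous_measurable_R3 (f : R * R * R -> R) : continuous f ->
  measurable_fun setT (f : R3 R -> R).
Proof.
move=> /continuousP cf; apply: (measurability _ (RGenOpens.measurableE R)).
move=> _ [_ [a [b ->] <-]]; rewrite setTI.
by apply: open_measurable_R3; exact/cf/interval_open.
Qed.

Lemma continuous_coord3 k : continuous (coord3 k : R * R * R -> R).
Proof.
case: k => [[|[|[|//]]]] ? x; rewrite /coord3 /=.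
- by apply: (@continuous_comp _ _ _ fst fst); exact: cvg_fst.
- by apply: (@continuous_comp _ _ _ fst snd); [exact: cvg_fst|exact: cvg_snd].
- exact: cvg_snd.
Qed.

Lemma sum_ord3 (V : nmodType) (F : 'I_3 -> V) :
  \sum_(k < 3) F k = F ord0 + F (lift ord0 ord0) + F (lift ord0 (lift ord0 ord0)).
Proof. by rewrite !big_ord_recl big_ord0 addr0 addrA. Qed.

Lemma continuous_sum_ord3 (F : 'I_3 -> R * R * R -> R) :
  (forall k, continuous (F k)) -> continuous (fun x => \sum_(k < 3) F k x).
Proof.
move=> cF; rewrite (_ : (fun x => _) = (fun x => F ord0 x + F (lift ord0 ord0) x +
  F (lift ord0 (lift ord0 ord0)) x)); last by apply/funext => x; rewrite sum_ord3.
by move=> x; apply: cvgD; [apply: cvgD|]; exact: cF.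
Qed.

Lemma compact_cube : compact cube.
Proof. by apply: compact_setX; [apply: compact_setX|]; exact: segment_compact. Qed.

Lemma continuous_bounded_cube (f : R * R * R -> R) : continuous f ->
  exists M, forall x, cube x -> `|f x| <= M.
Proof.
move=> cf; have /compact_bounded[M [_ HM]] : compact (f @` cube).
  by apply: continuous_compact compact_cube; exact: continuous_subspaceT.
exists (M + 1) => x cx; apply: (HM (M + 1)); first by rewrite ltrDl.
by exists x.
Qed.

Lemma continuous_sqint (f : R * R * R -> R) : continuous f ->
  sqint lebesgue3 B1 f.
Proof.
move=> cf; have [M HM] := continuous_bounded_cube cf.
apply: (@sqint_bounded _ _ _ _ _ measurable_unit_ball _ M).
- exact: unit_ball_lty.
- by apply: measurable_funTS; exact: continuous_measurable_R3.
- by move=> x /unit_ball_subset; exact: HM.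
Qed.

(** f is the product of two square integrable functions, itself and the constant 1. *)
Lemma continuous_integrable_ball (f : R * R * R -> R) : continuous f ->
  lebesgue3.-integrable B1 (EFin \o f).
Proof.
move=> cf; have f2 := continuous_sqint cf.
have c2 := continuous_sqint (@cst_continuous (R * R * R)%type R 1).
have := sqint_mul measurable_unit_ball f2 c2.
by rewrite /comp; under eq_fun do rewrite mulr1.
Qed.

End continuous_functions_on_space.

(** * Integration by parts in the ball *)

Section integration_by_parts_in_the_ball.
Context {R : realType}.
Local Notation lebesgue := (@lebesgue_measure R).
Local Notation lebesgue2 := (lebesgue \x lebesgue)%E.
Local Notation B1 := (@unit_ball R).
Local Notation cube := (`[-1, 1] `*` `[-1, 1] `*` `[-1, 1] : set (R * R * R)).

Lemma lineE (x : R * R * R) (k : 'I_3) (t : R) : x + t *: basis3 k =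
  (x.1.1 + t * (k == 0%N :> nat)%:R, x.1.2 + t * (k == 1%N :> nat)%:R,
   x.2 + t * (k == 2%N :> nat)%:R).
Proof. by case: x => -[]. Qed.

(** Both derivatives are limits of literally the same difference quotient. This passes between
    partial derivatives and one-variable calculus. *)
Lemma is_derive_line (g : R * R * R -> R) (x v : R * R * R) (t D : R) :
  is_derive t 1 (fun s : R => g (x + s *: v)) D <-> is_derive (x + t *: v) v g D.
Proof.
have E : (fun h : R => h^-1 *: (((fun s => g (x + s *: v)) \o shift t) (h *: 1)
    - g (x + t *: v))) =
  (fun h : R => h^-1 *: ((g \o shift (x + t *: v)) (h *: v) - g (x + t *: v))).
  apply/funext => h; congr (_ *: (g _ - _)).
  by rewrite /= /shift /= [h *: 1]mulr1 scalerDl addrCA.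
have E1 : derivable (fun s : R => g (x + s *: v)) t 1 = derivable g (x + t *: v) v.
  by rewrite /derivable E.
have E2 : 'D_1 (fun s : R => g (x + s *: v)) t = 'D_v g (x + t *: v).
  by rewrite /derive E.
by split=> -[dg Dg]; [rewrite E1 in dg; rewrite E2 in Dg
  |rewrite -E1 in dg; rewrite -E2 in Dg].
Qed.

(** [dh] lives on [-1, 1], where its integral is h(1) - h(-1); the hypothesis on [h] covers both
    endpoints. *)
Lemma integral_derivative_eq0 (h dh : R -> R) :
  (forall t : R, is_derive t 1 h (dh t)) -> continuous dh ->
  (forall t, t \notin `]-1, 1[ -> h t = 0) ->
  (forall t, t \notin `]-1, 1[ -> dh t = 0) ->
  (\int[lebesgue]_t (dh t)%:E = 0)%E.
Proof.
move=> hD cdh h0 dh0.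
have ch : continuous h.
  by move=> t; apply/differentiable_continuous/derivable1_diffP; have [] := hD t.
have -> : (\int[lebesgue]_t (dh t)%:E =
    \int[lebesgue]_(t in (`[(-1)%R, 1%R]%classic : set R)) (dh t)%:E)%E.
  rewrite [RHS]integral_mkcond; apply: eq_integral => t _; rewrite patchE.
  case: ifPn => // /negP tI; rewrite dh0//; apply: contra_notN tI.
  by rewrite inE /= => /subset_itv_oo_cc.
rewrite (@continuous_FTC2 R dh h)//.
- by rewrite !h0 ?subee// in_itv/= ltxx ?andbF.
- exact: continuous_subspaceT.
- split; first by move=> t _; have [] := hD t.
  + by apply: cvg_at_right_filter; exact: ch.
  + by apply: cvg_at_left_filter; exact: ch.
- by move=> t _; rewrite derive1E; have [] := hD t.
Qed.

Lemma bounded_support_integrable d (T : measurableType d)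
    (mu : {measure set T -> \bar R}) (A : set T) (f : T -> R) (M : R) :
  measurable A -> (mu A < +oo)%E -> measurable_fun setT f ->
  (forall x, `|f x| <= M) -> (forall x, ~ A x -> f x = 0) ->
  mu.-integrable setT (EFin \o f).
Proof.
move=> mA Afin mf fM f0.
have -> : EFin \o f = (EFin \o f) \_ A.
  apply/funext => x; rewrite patchE; case: ifPn => // /negP nA.
  by rewrite /= f0// => Ax; apply: nA; rewrite inE.
apply/(integrable_mkcond (EFin \o f) mA).
apply: (@le_integrable _ _ _ mu A mA _ (cst M%:E)).
- by apply/measurable_EFinP; exact: measurable_funTS.
- by move=> x _ /=; rewrite lee_fin (le_trans (fM x))// ler_norm.
- apply/integrableP; split => //=; rewrite integral_cst//=.
  by rewrite lte_mul_pinfty.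
Qed.

Local Notation square :=
  (`[-1, 1] `*` `[-1, 1] : set (measurableTypeR R * measurableTypeR R)).

Lemma square_lty : (lebesgue2 square < +oo)%E.
Proof.
rewrite [ltLHS]product_measure1E//= lebesgue_measure_itv/=; case: ifP => _.
  by rewrite -!EFinB -!EFinM ltry.
by rewrite !mule0 ltry.
Qed.

Lemma cube_lty : (@lebesgue3 R cube < +oo)%E.
Proof.
rewrite lebesgue3_box// lebesgue_measure_itv/=; case: ifP => _.
  by rewrite -!EFinB -!EFinM ltry.
by rewrite !mule0 ltry.
Qed.

Lemma product_integral_eq0 d1 d2 (T1 : measurableType d1) (T2 : measurableType d2)
    (m1 : {sigma_finite_measure set T1 -> \bar R})
    (m2 : {sigma_finite_measure set T2 -> \bar R}) (f : T1 * T2 -> \bar R) :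
  (m1 \x m2)%E.-integrable setT f ->
  (forall x, \int[m2]_y f (x, y) = 0)%E \/ (forall y, \int[m1]_x f (x, y) = 0)%E ->
  (\int[m1 \x m2]_z f z = 0)%E.
Proof.
move=> intf [f0|f0].
  by rewrite -integral12_prod_meas1//; apply: integral0_eq => x _; exact: f0.
by rewrite -integral21_prod_meas1//; apply: integral0_eq => x _; exact: f0.
Qed.

(* Unification finds no sigma-finite structure on [m1 \x m2]: the library's
   instance is shadowed by the one for products of subprobabilities. *)
Definition sigma_finite_product d1 d2 (T1 : measurableType d1) (T2 : measurableType d2)
    (m1 : {sigma_finite_measure set T1 -> \bar R})
    (m2 : {sigma_finite_measure set T2 -> \bar R}) :
    {sigma_finite_measure set (T1 * T2)%type -> \bar R} :=
  HB.pack_for {sigma_finite_measure set (T1 * T2)%type -> \bar R} (m1 \x m2)%E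
    (lebesgue_integral_fubini.measure_function_Measure_isSigmaFinite__to__measure_function_isSFinite m1 m2)
    (lebesgue_integral_fubini.measure_function_Measure_isSigmaFinite__to__measure_function_isSigmaFinite m1 m2).

(** Fubini with the k-th variable innermost. Base points with k-th coordinate 0 make the line
    parameter equal to that coordinate. *)
Lemma integral_lines_eq0 (k : 'I_3) (f : R * R * R -> R) : continuous f ->
  (forall x, ~ cube x -> f x = 0) ->
  (forall x, (coord3 k x = 0)%R -> \int[lebesgue]_t (f (x + t *: basis3 k))%:E = 0)%E ->
  (\int[lebesgue3]_x (f x)%:E = 0)%E.
Proof.
move=> cf f0 line0.
have [M HM] := continuous_bounded_cube cf.
have fM x : `|f x| <= `|M|.
  have [cx|ncx] := pselect (cube x); last by rewrite f0// normr0.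
  by rewrite (le_trans (HM _ cx))// ler_norm.
have mf := continuous_measurable_R3 cf.
have mcube : measurable (cube : set (R3 R)).
  by apply: measurableX; [apply: measurableX|]; exact: measurable_itv.
have msq : measurable square.
  by apply: measurableX; exact: measurable_itv.
have intf : (@lebesgue3 R).-integrable setT (EFin \o f).
  exact: (bounded_support_integrable mcube cube_lty).
(* The product is nested as (R * R) * R, so reaching either of the first two variables takes a
   second use of Fubini, on the slice at height z. *)
have intz (z : measurableTypeR R) :
    (lebesgue2).-integrable setT (EFin \o
      (fun xy : measurableTypeR R * measurableTypeR R => f (xy, z))).
  apply: (bounded_support_integrable msq square_lty) => //.
  - by apply: (measurableT_comp mf); exact: measurable_pair2.
  - by move=> xy nsq; apply: f0 => -[].
pose lebesgue2' := sigma_finite_product lebesgue lebesgue.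
case: k line0 => [[|[|[|//]]]] kP line0.
- apply: (@product_integral_eq0 _ _ _ _ lebesgue2' lebesgue _ intf); right => z.
  apply: (@product_integral_eq0 _ _ _ _ lebesgue lebesgue _ (intz z)); right => y.
  rewrite -[RHS](line0 (0, y, z))//; apply: eq_integral => t _.
  by rewrite lineE /= add0r mulr1 mulr0 !addr0.
- apply: (@product_integral_eq0 _ _ _ _ lebesgue2' lebesgue _ intf); right => z.
  apply: (@product_integral_eq0 _ _ _ _ lebesgue lebesgue _ (intz z)); left => x.
  rewrite -[RHS](line0 (x, 0, z))//; apply: eq_integral => t _.
  by rewrite lineE /= add0r mulr1 mulr0 !addr0.
- apply: (@product_integral_eq0 _ _ _ _ lebesgue2' lebesgue _ intf); left => -[x y].
  rewrite -[RHS](line0 (x, y, 0))//; apply: eq_integral => t _.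
  by rewrite lineE /= add0r mulr1 mulr0 !addr0.
Qed.

End integration_by_parts_in_the_ball.

(** * Partial derivatives of test functions and integration by parts *)

Section partial_derivatives.
Context {R : realType}.
Local Notation lebesgue := (@lebesgue_measure R).
Local Notation B1 := (@unit_ball R).

Lemma unit_ball_coord3 k (x : R * R * R) : B1 x -> coord3 k x \in `]-1, 1[.
Proof.
case: x => [[a b] c]; rewrite /unit_ball /= dotE /= => h.
have := sqr_ge0 a; have := sqr_ge0 b; have := sqr_ge0 c; rewrite !expr2 => *.
case: k => [[|[|[|//]]]] ?; rewrite /coord3 /= in_itv/= -ltr_norml
  -(@ltr_pXn2r _ 2)// ?nnegrE// expr1n real_normK ?num_real// expr2; lra.
Qed.

Lemma coord3_line k (x : R * R * R) (t : R) : coord3 k (x + t *: basis3 k) = coord3 k x + t.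
Proof.
by rewrite lineE; case: k => [[|[|[|//]]]] ?; rewrite /coord3 /= mulr1.
Qed.

(** Since [dG] vanishes off the ball, the integral may be taken over all of R^3. On each line in
    direction k, [G] vanishes when the k-th coordinate leaves ]-1, 1[, so the line integral of [dG]
    is zero. *)
Lemma integral_partial_eq0 k (G dG : R * R * R -> R) :
  (forall x, is_derive x (basis3 k) G (dG x)) -> continuous dG ->
  (forall x, ~ B1 x -> G x = 0) -> (forall x, ~ B1 x -> dG x = 0) ->
  \int[lebesgue3]_(x in B1) dG x = 0.
Proof.
move=> GD cdG G0 dG0; rewrite Rintegral_mkcond.
have -> : dG \_ B1 = dG.
  apply/funext => x; rewrite patchE; case: ifPn => // /negP nB.
  by rewrite dG0// => Bx; apply: nB; rewrite inE.
rewrite -[RHS]/(fine 0%E); congr fine; apply: (@integral_lines_eq0 _ k) => //.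
  by move=> x nc; apply: dG0 => Bx; apply: nc; exact: unit_ball_subset.
move=> x xk0.
apply: (@integral_derivative_eq0 _ (fun t => G (x + t *: basis3 k))).
- by move=> t; apply/is_derive_line.
- move=> t; apply: (@continuous_comp _ _ _ (fun t : R => x + t *: basis3 k) dG);
    last exact: cdG.
  by apply: cvgD; [exact: cvg_cst|apply: cvgZr_tmp; exact: cvg_id].
- move=> t tN; apply: G0; apply: contraNnot tN => /(@unit_ball_coord3 k).
  by rewrite coord3_line xk0 add0r.
- move=> t tN; apply: dG0; apply: contraNnot tN => /(@unit_ball_coord3 k).
  by rewrite coord3_line xk0 add0r.
Qed.

Lemma smooth_is_derive k (phi : R * R * R -> R) x : smooth phi ->
  is_derive x (basis3 k) phi (partial k phi x).
Proof. by move=> /(_ [::] x) /(@diff_derivable _ _ _ _ _ (basis3 k)) h; split. Qed.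

Lemma smooth_continuous (phi : R * R * R -> R) : smooth phi -> continuous phi.
Proof. by move=> sphi x; apply: differentiable_continuous; exact: (sphi [::]). Qed.

Lemma smooth_partial k (phi : R * R * R -> R) : smooth phi -> smooth (partial k phi).
Proof. by move=> sphi s x; have := sphi (rcons s k) x; rewrite foldr_rcons. Qed.

(** A compact [K] is closed, so [phi] vanishes near each point off [K], and the same [K] serves for
    the derivative. *)
Lemma test_function_partial k (phi : R * R * R -> R) :
  test_function phi -> test_function (partial k phi).
Proof.
move=> [sphi [K [cK KB phi0]]]; split; first exact: smooth_partial.
exists K; split => // x nKx; rewrite /partial.
rewrite (@near_eq_derive _ _ _ phi (cst 0)); first by have [] := is_derive_cst (0 : R) x (basis3 k).
have /compact_closed/(_ cK)/closed_openC oK : hausdorff_space (R * R * R)%type.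
  exact: norm_hausdorff.
have : nbhs x (~` K) by exact: open_nbhs_nbhs.
by apply: filterS => y /phi0 ->.
Qed.

Lemma test_function_eq0 (phi : R * R * R -> R) x :
  test_function phi -> ~ B1 x -> phi x = 0.
Proof. by move=> [_ [K [_ KB phi0]]] nB; apply: phi0 => /KB. Qed.

(** The product rule turns the sum of both sides into the integral of the k-th derivative of
    [g * phi], which vanishes off the ball because [phi] does. *)
Lemma ball_integration_by_parts k (g dg phi : R * R * R -> R) :
  (forall x, is_derive x (basis3 k) g (dg x)) -> continuous g -> continuous dg ->
  test_function phi ->
  \int[lebesgue3]_(x in B1) (g x * partial k phi x) =
  - \int[lebesgue3]_(x in B1) (dg x * phi x).
Proof.
move=> gD cg cdg tphi; have [sphi _] := tphi.
have cphi := smooth_continuous sphi.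
have cdphi := smooth_continuous (smooth_partial k sphi).
have c1 : continuous (fun x => g x * partial k phi x).
  by move=> x; apply: cvgM; [exact: cg|exact: cdphi].
have c2 : continuous (fun x => dg x * phi x).
  by move=> x; apply: cvgM; [exact: cdg|exact: cphi].
apply/eqP; rewrite -addr_eq0 -RintegralD; last 3 first.
- exact: measurable_unit_ball.
- exact: continuous_integrable_ball c1.
- exact: continuous_integrable_ball c2.
apply/eqP; apply: (@integral_partial_eq0 k (fun x => g x * phi x)).
- move=> x; have := is_deriveM (gD x) (smooth_is_derive k x sphi).
  by rewrite [phi x *: _]mulrC.
- by move=> x; apply: cvgD; [exact: c1|exact: c2].
- by move=> x nB; rewrite (test_function_eq0 tphi nB) mulr0.
- move=> x nB; rewrite (test_function_eq0 tphi nB).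
  by rewrite (test_function_eq0 (test_function_partial k tphi) nB) !mulr0 addr0.
Qed.

End partial_derivatives.

(** * Plane waves solve the Helmholtz equation *)

Section helmholtz_solutions.
Context {R : realType}.
Local Notation B1 := (@unit_ball R).
Implicit Types (kappa : R) (d x : R * R * R) (u w : @jet R).

Lemma Cintegrable_continuous (u : R3 R -> R[i]) (f : R * R * R -> R) :
  L2 lebesgue3 B1 u -> continuous f ->
  Cintegrable lebesgue3 B1 (fun x => u x * (f x)%:C%C).
Proof.
move=> u2 cf; have f2 : L2 lebesgue3 B1 (fun x => (f x)%:C%C).
  by apply/(L2P _ measurable_unit_ball); split; apply: continuous_sqint => //;
    exact: cst_continuous.
have := L2_mulC_integrable measurable_unit_ball u2 f2.
by under eq_fun do rewrite conjc_real.
Qed.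

Lemma CintegralD_ball (f g : R3 R -> R[i]) :
  Cintegrable lebesgue3 B1 f -> Cintegrable lebesgue3 B1 g ->
  Cintegral lebesgue3 B1 (fun x => f x + g x) =
  Cintegral lebesgue3 B1 f + Cintegral lebesgue3 B1 g.
Proof. exact: CintegralD measurable_unit_ball _ _. Qed.

Lemma CintegralZ_ball (a : R[i]) (f : R3 R -> R[i]) :
  Cintegrable lebesgue3 B1 f ->
  Cintegral lebesgue3 B1 (fun x => a * f x) = a * Cintegral lebesgue3 B1 f.
Proof. exact: CintegralZ measurable_unit_ball _ _. Qed.

Lemma continuous_laplacian (phi : R * R * R -> R) kappa : smooth phi ->
  continuous (fun x => laplacian phi x + kappa ^+ 2 * phi x).
Proof.
move=> sphi.
move=> x; apply: cvgD; last by apply: cvgMl_tmp; exact: smooth_continuous.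
apply: (@continuous_sum_ord3 _ (fun k => partial k (partial k phi))) => k.
by apply: smooth_continuous; do 2 apply: smooth_partial.
Qed.

Lemma test_axpy (a : R[i]) (u w : R3 R -> R[i]) (f : R * R * R -> R) :
  L2 lebesgue3 B1 u -> L2 lebesgue3 B1 w -> continuous f ->
  Cintegral lebesgue3 B1 (fun x => (a * u x + w x) * (f x)%:C%C) =
  a * Cintegral lebesgue3 B1 (fun x => u x * (f x)%:C%C) +
  Cintegral lebesgue3 B1 (fun x => w x * (f x)%:C%C).
Proof.
move=> u2 w2 cf; have uf := Cintegrable_continuous u2 cf.
have wf := Cintegrable_continuous w2 cf.
rewrite -CintegralZ_ball// -CintegralD_ball//; last first.
  exact: (CintegrableZ measurable_unit_ball).
by congr Cintegral; apply/funext => x; rewrite mulrDl mulrA.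
Qed.

Lemma helmholtz_space_axpy kappa a u w :
  helmholtz_space kappa u -> helmholtz_space kappa w ->
  helmholtz_space kappa (jet_axpy a u w).
Proof.
move=> [[u0 u1 du] hu] [[w0 w1 dw] hw].
have [l0 l1] := jet_axpy_L2 a (conj u0 u1) (conj w0 w1).
split; first split => //.
  move=> k phi tphi; have [sphi _] := tphi.
  rewrite /= !test_axpy//; last 2 first.
  - exact: smooth_continuous.
  - exact/smooth_continuous/smooth_partial.
  by rewrite du// dw// opprD mulrN.
move=> phi tphi; have [sphi _] := tphi.
rewrite /= test_axpy//; last exact: continuous_laplacian.
by rewrite hu// hw// mulr0 addr0.
Qed.

(** The direction is an arbitrary vector, so that it need not come from angles;
    [plane_wave kappa theta] is convertible to [pwave kappa (direction theta)]. *)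
Definition pwave kappa d : jet :=
  Jet (fun x => expi (kappa * dot d x))
      (fun k x => Complex 0 (kappa * coord3 k d) * expi (kappa * dot d x)).

Lemma continuous_dot d : continuous (dot d).
Proof.
apply: continuous_sum_ord3 => k x.
by apply: cvgMl_tmp; exact: continuous_coord3.
Qed.

Lemma continuous_phase kappa d (f : R -> R) : continuous f ->
  continuous (fun x => f (kappa * dot d x)).
Proof.
move=> cf x; apply: (@continuous_comp _ _ _ (fun x => kappa * dot d x) f); last exact: cf.
by apply: cvgMl_tmp; exact: continuous_dot.
Qed.

(** Along the line through x in direction k the phase is affine in t with slope
    [kappa * coord3 k d]; the chain rule at t = 0 does the rest. *)
Lemma is_derive_phase kappa d (f df : R -> R) k x :
  (forall t : R, is_derive t 1 f (df t)) ->
  is_derive x (basis3 k) (fun x => f (kappa * dot d x))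
    (kappa * coord3 k d * df (kappa * dot d x)).
Proof.
move=> fD.
have -> : x = x + 0 *: basis3 k by rewrite scale0r addr0.
apply/is_derive_line.
have dl t : dot d (x + t *: basis3 k) = dot d x + t * coord3 k d.
  rewrite lineE !dotE; case: k => [[|[|[|//]]]] ?; rewrite /coord3 /=;
  by rewrite mulr1 !mulr0; ring.
rewrite scale0r addr0; set a := kappa * dot d x.
have -> : (fun t : R => f (kappa * dot d (x + t *: basis3 k))) =
    (fun t : R => f (a + kappa * (t * coord3 k d))).
  by apply/funext => t; rewrite dl mulrDr.
set b := kappa * coord3 k d.
have aD : is_derive (0 : R) (1 : R) (fun t => a + kappa * (t * coord3 k d)) b.
  have := is_deriveD (is_derive_cst a (0 : R) (1 : R))
     (is_deriveZ b (is_derive_id (0 : R) (1 : R))).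
  rewrite add0r [b *: _]mulr1; congr is_derive; apply/funext => t.
  by rewrite -[LHS]/(a + b * t) /b; ring.
have [fd fE] := fD a; have [ad aE] := aD; rewrite /= in ad aE.
have a0 : a + kappa * (0 * coord3 k d) = a by rewrite mul0r mulr0 addr0.
split.
  apply/derivable1_diffP.
  apply: (@differentiable_comp _ _ _ _ (fun t : R => a + kappa * (t * coord3 k d)) f).
    exact/derivable1_diffP.
  by rewrite a0; apply/derivable1_diffP; exact: fd.
rewrite -derive1E (@derive1_comp _ (fun t : R => a + kappa * (t * coord3 k d)) f);
  [by rewrite !derive1E a0 fE aE mulrC|exact: ad|by rewrite a0; exact: fd].
Qed.

Lemma pwave_L2 kappa d : jet_L2 (pwave kappa d).
Proof.
have cc := continuous_sqint (@continuous_phase kappa d _ (@continuous_cos R)).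
have cs := continuous_sqint (@continuous_phase kappa d _ (@continuous_sin R)).
have mB := @measurable_unit_ball R.
split=> [|k]; apply/(L2P _ mB); split => //.
  by apply: (sqintB mB); apply: (sqintZ mB).
by apply: (sqintD mB); apply: (sqintZ mB).
Qed.

Lemma pwave_weak_partial kappa d k :
  weak_partial k (jval (pwave kappa d)) (jgrad (pwave kappa d) k).
Proof.
move=> phi tphi; apply: complex_ext; rewrite ReImE /=.
  under eq_Rintegral do rewrite mulr0 subr0.
  rewrite (@ball_integration_by_parts _ k _ _ _ (fun x =>
    @is_derive_phase kappa d _ _ k x (@is_derive_cos R)))//; last 2 first.
  - exact: continuous_phase (@continuous_cos R).
  - move=> x; apply: cvgMl_tmp; apply: (@continuous_phase kappa d (fun t => - sin t)).
    by move=> t; apply: cvgN; exact: continuous_sin.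
  by congr (- _); apply: eq_Rintegral => x _ /=; ring.
under eq_Rintegral do rewrite mulr0 add0r.
rewrite (@ball_integration_by_parts _ k _ _ _ (fun x =>
  @is_derive_phase kappa d _ _ k x (@is_derive_sin R)))//; last 2 first.
- exact: continuous_phase (@continuous_sin R).
- by move=> x; apply: cvgMl_tmp; apply: (@continuous_phase kappa d _ (@continuous_cos R)).
by congr (- _); apply: eq_Rintegral => x _ /=; ring.
Qed.

(** Using the weak gradient twice moves both derivatives off the test function and leaves the factor
    (i kappa d_k)^2. Summed over k this is - kappa^2 |d|^2, which cancels kappa^2. *)
Lemma pwave_helmholtz kappa d : dot d d = 1 -> helmholtz_space kappa (pwave kappa d).
Proof.
move=> d1; have [u0 u1] := pwave_L2 kappa d.
split; first by split => // k; exact: pwave_weak_partial.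
move=> phi tphi; have [sphi _] := tphi.
pose I f := Cintegral lebesgue3 B1 (fun x => jval (pwave kappa d) x * (f x)%:C%C).
have cI (f : R * R * R -> R) : continuous f ->
    Cintegrable lebesgue3 B1 (fun x => jval (pwave kappa d) x * (f x)%:C%C).
  exact: Cintegrable_continuous.
have partialI k f : test_function f ->
    I (partial k f) = - (Complex 0 (kappa * coord3 k d) * I f).
  move=> tf; rewrite /I pwave_weak_partial// -CintegralZ_ball; last first.
    by apply: cI; apply: smooth_continuous; case: tf.
  by congr (- Cintegral _ _ _); apply/funext => x; rewrite mulrA.
have -> : Cintegral lebesgue3 B1 (fun x => jval (pwave kappa d) x *
    (laplacian phi x + kappa ^+ 2 * phi x)%:C%C) =
    \sum_(k < 3) I (partial k (partial k phi)) + (kappa ^+ 2)%:C%C * I phi.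
  rewrite -Cintegral_sum; last 2 first.
  - exact: measurable_unit_ball.
  - by move=> k; apply: cI; apply: smooth_continuous; do 2 apply: smooth_partial.
  rewrite -CintegralZ_ball; last by apply: cI; exact: smooth_continuous.
  rewrite -CintegralD_ball; last 2 first.
  - apply: Cintegrable_sum; first exact: measurable_unit_ball.
    by move=> k; apply: cI; apply: smooth_continuous; do 2 apply: smooth_partial.
  - apply: CintegrableZ; first exact: measurable_unit_ball.
    by apply: cI; exact: smooth_continuous.
  congr Cintegral; apply/funext => x; rewrite -mulr_sumr mulrCA -mulrDr.
  by congr (_ * _); rewrite rmorphD rmorphM rmorph_sum.
under eq_bigr => k _.
  rewrite partialI; last exact: test_function_partial.
  rewrite partialI// mulrN opprK mulrA; over.
rewrite -mulr_suml -mulrDl; apply/eqP; rewrite mulf_eq0; apply/orP; left; apply/eqP.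
rewrite sum_ord3.
apply: complex_ext; rewrite !ReImE /= ?cReC ?cImC; last by ring.
have : kappa ^+ 2 * dot d d = kappa ^+ 2 by rewrite d1 mulr1.
rewrite /dot sum_ord3 => h.
set x := coord3 _ _ in h *; set y := coord3 _ _ in h *; set z := coord3 _ _ in h *.
rewrite -[X in _ + X = _]h; ring.
Qed.

End helmholtz_solutions.

(** * The Bessel property *)

Section measurability_in_the_parameter.
Context {R : realType} {d1 d2 : measure_display}.
Context {T1 : measurableType d1} {T2 : measurableType d2}.
Implicit Types (f g : T1 -> R[i]).

(** The integral is the difference of those of the positive and negative parts, each measurable in
    the parameter by Tonelli. *)
Lemma measurable_Rintegral_param (m2 : {sigma_finite_measure set T2 -> \bar R})
    (F : T1 * T2 -> R) : measurable_fun setT F ->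
  measurable_fun setT (fun x => \int[m2]_y F (x, y)).
Proof.
move=> mF; have mE : measurable_fun setT (EFin \o F) by apply/measurable_EFinP.
have E (x : T1) : (\int[m2]_y (F (x, y))%:E =
    fubini_F m2 (EFin \o F)^\+ x - fubini_F m2 (EFin \o F)^\- x)%E.
  by rewrite integralE; congr (_ - _)%E; apply: eq_integral => y _;
    rewrite ?funeposE ?funenegE.
apply: (measurableT_comp (f := fine)) => //.
apply: (eq_measurable_fun (fubini_F m2 (EFin \o F)^\+ \- fubini_F m2 (EFin \o F)^\-)%E).
  by move=> x _; rewrite E.
apply: emeasurable_funB; apply: measurable_fun_fubini_tonelli_F => //.
  exact: measurable_funepos.
exact: measurable_funeneg.
Qed.

Lemma Cmeasurable_funD (D : set T1) f g : Cmeasurable_fun D f -> Cmeasurable_fun D g ->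
  Cmeasurable_fun D (fun x => f x + g x).
Proof.
move=> [fr fi] [gr gi]; split.
  by under eq_fun do rewrite cReD; exact: measurable_funD.
by under eq_fun do rewrite cImD; exact: measurable_funD.
Qed.

Lemma Cmeasurable_funM (D : set T1) f g : Cmeasurable_fun D f -> Cmeasurable_fun D g ->
  Cmeasurable_fun D (fun x => f x * g x).
Proof.
move=> [fr fi] [gr gi]; split.
  under eq_fun do rewrite cReM.
  by apply: measurable_funB; exact: measurable_funM.
under eq_fun do rewrite cImM.
by apply: measurable_funD; exact: measurable_funM.
Qed.

Lemma Cmeasurable_fun_cst (D : set T1) (a : R[i]) : Cmeasurable_fun D (fun=> a).
Proof. by split; exact: measurable_cst. Qed.

(** Extending [u] by zero off [D] makes the integrand jointly measurable on the whole product, where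
    the real-valued lemma applies to each part. *)
Lemma Cmeasurable_Cintegral_param (m2 : {sigma_finite_measure set T2 -> \bar R})
    (D : set T2) (u : T2 -> R[i]) (p : T1 * T2 -> R[i]) :
  measurable D -> Cmeasurable_fun D u -> Cmeasurable_fun setT p ->
  Cmeasurable_fun setT (fun x => Cintegral m2 D (fun y => u y * conjc (p (x, y)))).
Proof.
move=> mD [ur ui] [pr pi].
have mr : measurable_fun setT ((fun y => Re (u y)) \_ D).
  exact/(measurable_restrictT _ mD).
have mi : measurable_fun setT ((fun y => Im (u y)) \_ D).
  exact/(measurable_restrictT _ mD).
have m2r := measurableT_comp mr (@measurable_snd _ _ T1 T2).
have m2i := measurableT_comp mi (@measurable_snd _ _ T1 T2).
split.
  under eq_fun => x.
    rewrite /Cintegral /= Rintegral_mkcond.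
    rewrite (@eq_Rintegral _ _ _ _ _ (fun y =>
      ((fun y => Re (u y)) \_ D) (x, y).2 * Re (p (x, y)) +
      ((fun y => Im (u y)) \_ D) (x, y).2 * Im (p (x, y)))); last first.
      move=> y _; rewrite /= !patchE; case: ifP => _; last by rewrite !mul0r addr0.
      by rewrite !ReImE; ring.
    over.
  apply: (@measurable_Rintegral_param _ (fun z => _ z.2 * Re (p z) + _ z.2 * Im (p z))).
  by apply: measurable_funD; exact: measurable_funM.
under eq_fun => x.
  rewrite /Cintegral /= Rintegral_mkcond.
  rewrite (@eq_Rintegral _ _ _ _ _ (fun y =>
    ((fun y => Im (u y)) \_ D) (x, y).2 * Re (p (x, y)) -
    ((fun y => Re (u y)) \_ D) (x, y).2 * Im (p (x, y)))); last first.
    move=> y _; rewrite /= !patchE; case: ifP => _; last by rewrite !mul0r subr0.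
    by rewrite !ReImE; ring.
  over.
apply: (@measurable_Rintegral_param _ (fun z => _ z.2 * Re (p z) - _ z.2 * Im (p z))).
by apply: measurable_funB; exact: measurable_funM.
Qed.

End measurability_in_the_parameter.

(** * Products with plane waves as functions of the direction *)

Section plane_wave_bessel_family.
Context {R : realType}.
Local Notation lebesgue := (@lebesgue_measure R).
Local Notation B1 := (@unit_ball R).
Local Notation R2 := (measurableTypeR R * measurableTypeR R)%type.
Implicit Types (kappa : R) (theta : R2) (u : @jet R).

Lemma dot_direction theta : dot (direction theta) (direction theta) = 1.
Proof.
rewrite dotE /direction /=.
transitivity (sin theta.1 ^+ 2 * (cos theta.2 ^+ 2 + sin theta.2 ^+ 2) + cos theta.1 ^+ 2).
  ring.
by rewrite cos2Dsin2 mulr1 addrC cos2Dsin2.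
Qed.

Lemma measurable_coord3_direction k :
  measurable_fun setT (fun theta : R2 => coord3 k (direction theta)).
Proof.
have mc (g : R2 -> R) : measurable_fun setT g -> measurable_fun setT (fun theta => cos (g theta)).
  by apply: measurableT_comp; apply: continuous_measurable_fun; exact: continuous_cos.
have ms (g : R2 -> R) : measurable_fun setT g -> measurable_fun setT (fun theta => sin (g theta)).
  by apply: measurableT_comp; apply: continuous_measurable_fun; exact: continuous_sin.
case: k => [[|[|[|//]]]] ?; rewrite /coord3 /=.
- by apply: measurable_funM; [exact: ms|exact: mc].
- by apply: measurable_funM; exact: ms.
- exact: mc.
Qed.

Lemma Cmeasurable_plane_wave_prod kappa u : helmholtz_space kappa u ->
  Cmeasurable_fun setT (fun theta : R2 => helmholtz_prod kappa u (plane_wave kappa theta)).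
Proof.
move=> /helmholtz_space_L2 u2.
pose l3 := sigma_finite_product (sigma_finite_product lebesgue lebesgue) lebesgue.
have mphase (f : R -> R) : continuous f ->
    measurable_fun setT (fun z : R2 * R3 R => f (kappa * dot (direction z.1) z.2)).
  move=> cf; apply: measurableT_comp; first exact: continuous_measurable_fun.
  apply: measurable_funM => //; apply: measurable_sum => k; apply: measurable_funM.
    exact: (measurableT_comp (measurable_coord3_direction k) measurable_fst).
  exact: (measurableT_comp (measurable_coord3 k) measurable_snd).
have mexp : Cmeasurable_fun setT (fun z : R2 * R3 R => expi (kappa * dot (direction z.1) z.2)).
  by split; apply: mphase; [exact: continuous_cos|exact: continuous_sin].
have mB := @measurable_unit_ball R.
have -> : (fun theta => helmholtz_prod kappa u (plane_wave kappa theta)) = (fun theta =>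
    Cintegral lebesgue3 B1 (fun x => jval u x * conjc (expi (kappa * dot (direction theta) x))) +
    (kappa ^- 2)%:C%C * \sum_(k < 3) Cintegral lebesgue3 B1
    (fun x => jgrad u k x * conjc (Complex 0 (kappa * coord3 k (direction theta)) *
                  expi (kappa * dot (direction theta) x)))).
  by apply/funext => theta; rewrite helmholtz_prodE//; exact: pwave_L2.
case: u2 => [[u0 _] u1].
apply: Cmeasurable_funD.
  exact: (@Cmeasurable_Cintegral_param _ _ _ _ _ l3 B1 (jval u)
    (fun z => expi (kappa * dot (direction z.1) z.2)) mB u0 mexp).
apply: Cmeasurable_funM; first exact: Cmeasurable_fun_cst.
have mk k : Cmeasurable_fun setT (fun theta => Cintegral lebesgue3 B1
    (fun x => jgrad u k x * conjc (Complex 0 (kappa * coord3 k (direction theta)) *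
                  expi (kappa * dot (direction theta) x)))).
  have [u1k _] := u1 k.
  apply: (@Cmeasurable_Cintegral_param _ _ _ _ _ l3 B1 (jgrad u k)
    (fun z => Complex 0 (kappa * coord3 k (direction z.1)) *
              expi (kappa * dot (direction z.1) z.2)) mB u1k).
  apply: Cmeasurable_funM; last exact: mexp.
  split; first exact: measurable_cst.
  apply: measurable_funM => //.
  exact: (measurableT_comp (measurable_coord3_direction k) measurable_fst).
under eq_fun do rewrite sum_ord3.
by do 2 ?apply: Cmeasurable_funD.
Qed.

Lemma normc_expi (t : R) : normc (expi t) ^+ 2 = 1.
Proof. by rewrite normc_sqr cos2Dsin2. Qed.

(** The wave has modulus 1 and its gradient has modulus kappa, so the two terms of the norm
    contribute |B_1| each. *)
Lemma pwave_norm kappa d : 0 < kappa -> dot d d = 1 ->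
  helmholtz_norm kappa (pwave kappa d) ^+ 2 = 2 * fine (@lebesgue3 R B1).
Proof.
move=> k0 d1; have mB := @measurable_unit_ball R.
have normE (f : R3 R -> R[i]) c : (forall x, normc (f x) ^+ 2 = c) ->
    L2norm lebesgue3 B1 f ^+ 2 = c * fine (@lebesgue3 R B1).
  move=> fc; rewrite sqr_sqrtr; last by apply: Rintegral_ge0 => x _; exact: sqr_ge0.
  by rewrite (@eq_Rintegral _ _ _ _ _ (fun=> c))// Rintegral_cst.
have gradE k : L2norm lebesgue3 B1 (jgrad (pwave kappa d) k) ^+ 2 =
    kappa ^+ 2 * (coord3 k d * coord3 k d) * fine (@lebesgue3 R B1).
  apply: normE => x.
  rewrite ComplexField.Normc.normcM exprMn normc_expi mulr1 normc_sqr /= expr0n /=.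
  ring.
rewrite sqr_sqrtr; last first.
  apply: addr_ge0; first exact: sqr_ge0.
  by apply: mulr_ge0; [rewrite invr_ge0 sqr_ge0|apply: sumr_ge0 => k _; exact: sqr_ge0].
rewrite (normE _ 1) => [|x]; last exact: normc_expi.
under eq_bigr do rewrite gradE.
rewrite -mulr_suml -mulr_sumr -/(dot d d) d1.
by field; rewrite gt_eqF.
Qed.

Lemma plane_wave_bessel kappa : 0 < kappa ->
  bessel_family kappa (@sphere_measure R) Theta (plane_wave kappa).
Proof.
move=> k0; have mT : measurable (@Theta R).
  by apply: measurableX; exact: measurable_itv.
have Tfin : (@sphere_measure R Theta < +oo)%E by rewrite -ge0_fin_numE// fin_num_measure.
set M := 2 * fine (@lebesgue3 R B1).
have M0 : 0 <= M by rewrite mulr_ge0// fine_ge0.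
split.
- by move=> theta _; apply: pwave_helmholtz; exact: dot_direction.
- move=> u /Cmeasurable_plane_wave_prod[mr mi].
  by split; exact: measurable_funTS.
(* Pointwise Cauchy-Schwarz gives the bound M sigma(Theta); the added 1 makes the constant strictly
   positive. *)
- exists (M * fine (@sphere_measure R Theta) + 1); split.
    by rewrite ltr_wpDl// mulr_ge0// fine_ge0.
  move=> u hu; have [mr mi] := Cmeasurable_plane_wave_prod hu.
  apply: (@le_trans _ _ (\int[@sphere_measure R]_(theta in Theta)
      (cst (M * helmholtz_norm kappa u ^+ 2)%:E theta))%E).
    apply: ge0_le_integral => //.
    - by move=> theta _; rewrite lee_fin sqr_ge0.
    - apply/measurable_EFinP; apply: measurable_funTS.
      under eq_fun do rewrite normc_sqr.
      by apply: measurable_funD; exact: measurable_funX.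
    move=> theta _; rewrite lee_fin /M -(pwave_norm k0 (dot_direction theta)) mulrC -exprMn.
    rewrite lerXn2r ?nnegrE ?normc_nneg ?mulr_ge0 ?sqrtr_ge0//.
    by apply: helmholtz_Cauchy_Schwarz; [exact: helmholtz_space_L2 hu|exact: pwave_L2].
  have sE : sphere_measure (@Theta R) = (fine (sphere_measure (@Theta R)))%:E.
    by rewrite fineK// ge0_fin_numE.
  rewrite integral_cst// [X in (_ * X)%E]sE -EFinM lee_fin mulrAC ler_wpM2r ?sqr_ge0// lerDl//.
Qed.

End plane_wave_bessel_family.

(** * Orthonormal families of waves *)

Section exponential_sums.
Context {R : realType}.
Local Notation B1 := (@unit_ball R).
Local Notation lebesgue := (@lebesgue_measure R).

Lemma ball_integral_gt0 (f : R * R * R -> R) x0 : continuous f ->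
  (forall x, 0 <= f x) -> B1 x0 -> 0 < f x0 -> 0 < \int[lebesgue3]_(x in B1) f x.
Proof.
move=> cf f0 Bx0 fx0; have mB := @measurable_unit_ball R.
have cd : continuous (fun x : R * R * R => dot x x).
  apply: continuous_sum_ord3 => k x.
  by apply: cvgM; exact: continuous_coord3.
have U : \forall x \near x0, dot x x < 1 /\ f x0 / 2 < f x.
  apply: filterI; first exact: (cvgr_lt _ (cd x0) 1 Bx0).
  by apply: (cvgr_gt _ (cf x0)); lra.
have /nbhs_ballP[e /= e0 eU] := U.
(* Balls of the product metric are boxes, so this is the ball given by continuity, and its measure
   is a product of lengths. *)
pose A : set (R3 R) := ball (x0.1.1 : R) e `*` ball (x0.1.2 : R) e `*` ball (x0.2 : R) e.
have AU x : A x -> dot x x < 1 /\ f x0 / 2 < f x by exact: eU.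
have mA : measurable A.
  by apply: measurableX; [apply: measurableX|]; exact: measurable_ball.
have Apos : (0 < @lebesgue3 R A)%E.
  rewrite /A lebesgue3_box//; try exact: measurable_ball.
  by rewrite !lebesgue_measure_ball ?ltW// -!EFinM lte_fin !mulr_gt0 ?pmulrn_lgt0.
have intf := continuous_integrable_ball cf.
have mf : measurable_fun setT (EFin \o (f : R3 R -> R)).
  by apply/measurable_EFinP; exact: continuous_measurable_R3.
rewrite -lte_fin fineK; last exact: integrable_fin_num.
have lb : ((f x0 / 2)%:E * lebesgue3 A <= \int[lebesgue3]_(x in B1) (f x)%:E)%E.
  apply: (@le_trans _ _ (\int[lebesgue3]_(x in A) (f x)%:E)%E).
    rewrite -integral_cst//; apply: ge0_le_integral => //=.
    - by move=> x _; rewrite lee_fin divr_ge0// ltW.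
    - exact: measurable_funTS.
    - by move=> x /AU[_ /ltW]; rewrite lee_fin.
  apply: ge0_subset_integral => //.
  - exact: measurable_funTS.
  - by move=> x _; rewrite lee_fin.
  - by move=> x /AU[].
by apply: lt_le_trans lb; rewrite mule_gt0// lte_fin divr_gt0.
Qed.

Lemma expiD (s t : R) : expi (s + t) = expi s * expi t.
Proof. by apply: complex_ext; rewrite ReImE /= ?cosD ?sinD //; ring. Qed.

Lemma expiMn (t : R) m : expi (t *+ m) = expi t ^+ m.
Proof.
elim: m => [|m IH]; last by rewrite mulrS expiD exprS IH.
by rewrite mulr0n expr0; apply: complex_ext; rewrite /= ?cos0 ?sin0.
Qed.

(** The equations form a Vandermonde system with nodes [expi (tau * j)]. The bound on [tau * n]
    keeps the phases in [0, pi], where the cosine is injective, so the nodes are distinct. *)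
Lemma exponential_sum_eq0 (n : nat) (tau : R) (v : 'rV[R[i]]_n) :
  0 < tau -> tau * n%:R <= 1 ->
  (forall m : 'I_n, \sum_(j < n) v 0 j * expi (tau * (m * j)%:R) = 0) -> v = 0.
Proof.
move=> t0 tn vE; pose a : 'rV[R[i]]_n := \row_j expi (tau * j%:R).
have range (j : 'I_n) : tau * j%:R \in `[0, pi].
  rewrite in_itv/= mulr_ge0 ?(ltW t0)//=; apply: (@le_trans _ _ (tau * n%:R)).
    by rewrite ler_pM2l// ler_nat ltnW.
  by apply: (le_trans tn); have := pi_ge2 R; lra.
have detN0 : \det (Vandermonde n a)^T != 0.
  rewrite det_tr det_Vandermonde; apply/prodf_neq0 => i _; apply/prodf_neq0 => j ij.
  rewrite !mxE subr_eq0; apply/eqP => /(congr1 (@complex.Re R)) /=.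
  move/(cos_inj (range j) (range i))/(mulfI (lt0r_neq0 t0))/eqP.
  by rewrite eqr_nat gtn_eqF.
have : v *m (Vandermonde n a)^T = 0.
  apply/rowP => m; rewrite !mxE -[RHS](vE m); apply: eq_bigr => j _.
  by rewrite !mxE -expiMn -mulrnAr -mulrnA mulnC.
move/(congr1 (mulmx^~ (invmx (Vandermonde n a)^T))).
by rewrite mulmxK ?mul0mx// unitmxE unitfE.
Qed.

End exponential_sums.

(** * Combinations of plane waves and orthonormal families *)

Section orthonormal_waves.
Context {R : realType}.
Local Notation B1 := (@unit_ball R).
Implicit Types (kappa : R) (c : nat -> R[i]) (d : nat -> R * R * R) (u : @jet R).

Definition jet0 : @jet R := Jet (fun=> 0) (fun _ => fun=> 0).

(** Gives the properties of the zero jet from closure and linearity under [jet_axpy]. *)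
Lemma jet0E u : jet0 = jet_axpy (-1) u u.
Proof.
by congr Jet; [apply/funext => x|apply/funext => k; apply/funext => x];
  rewrite mulN1r addNr.
Qed.

Fixpoint wave_sum kappa c d n : jet :=
  if n is m.+1 then jet_axpy (c m) (pwave kappa (d m)) (wave_sum kappa c d m)
  else jet0.

Lemma wave_sumE kappa c d n x :
  jval (wave_sum kappa c d n) x = \sum_(k < n) c k * expi (kappa * dot (d k) x).
Proof. by elim: n => [|n IH] /=; rewrite ?big_ord0// big_ord_recr /= IH addrC. Qed.

Lemma jet0_helmholtz kappa : helmholtz_space kappa jet0.
Proof.
have h : helmholtz_space kappa (pwave kappa (0, 0, 1)).
  by apply: pwave_helmholtz; rewrite dotE /=; ring.
by rewrite (jet0E (pwave kappa (0, 0, 1))); exact: helmholtz_space_axpy.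
Qed.

Lemma wave_sum_helmholtz kappa c d n : (forall k, (k < n)%N -> dot (d k) (d k) = 1) ->
  helmholtz_space kappa (wave_sum kappa c d n).
Proof.
elim: n => [|n IH] dn /=; first exact: jet0_helmholtz.
apply: helmholtz_space_axpy; first by apply: pwave_helmholtz; exact: dn.
by apply: IH => k kn; apply: dn; exact: ltnW.
Qed.

Lemma jet0_prod kappa u : jet_L2 u -> helmholtz_prod kappa jet0 u = 0.
Proof. by move=> u2; rewrite (jet0E u) helmholtz_prod_axpy// mulN1r addNr. Qed.

Lemma wave_sum_prod kappa c d n u : (forall k, (k < n)%N -> dot (d k) (d k) = 1) ->
  jet_L2 u -> helmholtz_prod kappa (wave_sum kappa c d n) u =
  \sum_(k < n) c k * helmholtz_prod kappa (pwave kappa (d k)) u.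
Proof.
elim: n => [|n IH] dn u2; first by rewrite big_ord0 jet0_prod.
have dn' k : (k < n)%N -> dot (d k) (d k) = 1 by move=> kn; apply: dn; exact: ltnW.
rewrite helmholtz_prod_axpy ?IH// ?big_ord_recr/= 1?addrC//.
  exact: pwave_L2.
by apply: (@helmholtz_space_L2 _ kappa); exact: wave_sum_helmholtz.
Qed.

Lemma wave_sum_continuous kappa c d n :
  continuous (fun x => Re (jval (wave_sum kappa c d n) x)) /\
  continuous (fun x => Im (jval (wave_sum kappa c d n) x)).
Proof.
elim: n => [|n [cr ci]] /=; first by split; exact: cst_continuous.
have cc := @continuous_phase _ kappa (d n) _ (@continuous_cos R).
have cs := @continuous_phase _ kappa (d n) _ (@continuous_sin R).
split.
  rewrite (_ : (fun x => _) = (fun x => Re (c n) * cos (kappa * dot (d n) x) -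
    Im (c n) * sin (kappa * dot (d n) x) + Re (jval (wave_sum kappa c d n) x))).
    by move=> x; apply: cvgD (cr x); apply: cvgB; apply: cvgMl_tmp; [exact: cc|exact: cs].
  by apply/funext => x; rewrite !ReImE.
rewrite (_ : (fun x => _) = (fun x => Re (c n) * sin (kappa * dot (d n) x) +
  Im (c n) * cos (kappa * dot (d n) x) + Im (jval (wave_sum kappa c d n) x))).
  by move=> x; apply: cvgD (ci x); apply: cvgD; apply: cvgMl_tmp; [exact: cs|exact: cc].
by apply/funext => x; rewrite !ReImE.
Qed.

Lemma wave_sum_norm_gt0 kappa c d n x : B1 x ->
  jval (wave_sum kappa c d n) x != 0 -> 0 < helmholtz_norm kappa (wave_sum kappa c d n).
Proof.
move=> Bx nz; rewrite sqrtr_gt0; apply: ltr_pwDl; last first.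
  by apply: mulr_ge0; [rewrite invr_ge0 sqr_ge0|apply: sumr_ge0 => k _; exact: sqr_ge0].
have [cr ci] := wave_sum_continuous kappa c d n.
rewrite sqr_sqrtr; last by apply: Rintegral_ge0 => y _; exact: sqr_ge0.
apply: (@ball_integral_gt0 _ _ x) => //.
- rewrite (_ : (fun y => _) = (fun y => Re (jval (wave_sum kappa c d n) y) *
    Re (jval (wave_sum kappa c d n) y) + Im (jval (wave_sum kappa c d n) y) *
    Im (jval (wave_sum kappa c d n) y))).
    by move=> y; apply: cvgD; apply: cvgM; [exact: cr|exact: cr|exact: ci|exact: ci].
  by apply/funext => y; rewrite normc_sqr !expr2.
- by move=> y; exact: sqr_ge0.
- rewrite exprn_gt0// lt_neqAle normc_nneg andbT eq_sym.
  by apply: contraNneq nz => /ComplexField.Normc.eq0_normc ->.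
Qed.

(* Equally spaced third coordinates: on the vertical axis a combination of
   these waves is a combination of powers, and vanishing at enough points is a
   Vandermonde system. *)
Definition slanted (n j : nat) : R * R * R :=
  (Num.sqrt (1 - (j%:R / n%:R) ^+ 2), 0, j%:R / n%:R).

Lemma dot_slanted n j : (j < n)%N -> dot (slanted n j) (slanted n j) = 1.
Proof.
move=> jn; rewrite dotE /= -!expr2 sqr_sqrtr; first by ring.
have n0 : (0 : R) < n%:R by rewrite ltr0n (leq_ltn_trans _ jn).
rewrite subr_ge0 expr_le1// ?divr_ge0//.
by rewrite ler_pdivrMr// mul1r ler_nat ltnW.
Qed.

Lemma slanted_sum_eq0 kappa (n : nat) (v : 'rV[R[i]]_n) c : 0 < kappa ->
  (forall j : 'I_n, c j = v 0 j) ->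
  (forall x, B1 x -> jval (wave_sum kappa c (slanted n) n) x = 0) -> v = 0.
Proof.
case: n v => [|n] v k0 cv w0; first by apply/rowP => -[].
have n0 : (0 : R) < n.+1%:R by rewrite ltr0n.
(* Spacing of the sample points (0, 0, m h). The factor [n.+1] keeps them in the ball, and
   [kappa + 1] gives [kappa * h <= 1], the smallness asked of the phases; the phase of wave j at
   sample m is then [kappa * h / n.+1] times mj. *)
pose h : R := (n.+1%:R * (kappa + 1))^-1.
have k1 : 0 < kappa + 1 by rewrite addr_gt0.
have h0 : 0 < h by rewrite invr_gt0 mulr_gt0.
apply: (@exponential_sum_eq0 _ _ (kappa * h / n.+1%:R)).
- by rewrite divr_gt0 ?mulr_gt0.
- rewrite mulfVK ?gt_eqF// ler_pdivrMr ?mulr_gt0// mul1r.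
  have : (1 : R) <= n.+1%:R by rewrite ler1n.
  nra.
move=> m; have mh : m%:R * h < 1.
  rewrite ltr_pdivrMr ?mulr_gt0// mul1r.
  have : (m%:R : R) < n.+1%:R by rewrite ltr_nat.
  nra.
have Bx : B1 (0, 0, m%:R * h).
  rewrite /unit_ball /= dotE /= !mul0r !add0r.
  have : 0 <= m%:R * h by rewrite mulr_ge0// ltW.
  nra.
rewrite -[RHS](w0 _ Bx) wave_sumE; apply: eq_bigr => j _; rewrite cv.
congr (_ * expi _); rewrite dotE /= natrM; field.
by rewrite gt_eqF.
Qed.

(** By induction: orthogonality to N vectors is N linear conditions on the N+1 coefficients of a
    fresh combination of slanted waves, so a nonzero solution exists, and it is normalised. *)
Lemma orthonormal_waves kappa N : 0 < kappa -> exists e : nat -> jet,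
  (forall i, (i < N)%N -> helmholtz_space kappa (e i)) /\
  (forall i j, (i < N)%N -> (j < N)%N ->
    helmholtz_prod kappa (e i) (e j) = (i == j)%:R).
Proof.
move=> k0; elim: N => [|N [e [he ee]]]; first by exists (fun=> jet0); split.
pose d := slanted N.+1.
have dd k : (k < N.+1)%N -> dot (d k) (d k) = 1 by exact: dot_slanted.
pose A : 'M[R[i]]_(N.+1, N) :=
  \matrix_(j, i) helmholtz_prod kappa (pwave kappa (d j)) (e i).
(* [A] has more rows than columns, so its left kernel is nonzero. *)
pose v := nz_row (kermx A).
have vN0 : v != 0.
  rewrite nz_row_eq0 kermx_eq0 /row_free neq_ltn.
  by rewrite ltnS rank_leq_col.
have vA : v *m A = 0 by apply/sub_kermxP; exact: nz_row_sub.
pose c k : R[i] := v 0 (inord k).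
have cv (j : 'I_N.+1) : c j = v 0 j by rewrite /c inord_val.
pose q := wave_sum kappa c d N.+1.
have hq : helmholtz_space kappa q by exact: wave_sum_helmholtz.
have qe i : (i < N)%N -> helmholtz_prod kappa q (e i) = 0.
  move=> iN; rewrite wave_sum_prod//; last exact: helmholtz_space_L2 (he i iN).
  have := congr1 (fun B : 'rV_N => B 0 (Ordinal iN)) vA; rewrite !mxE => vAi.
  by rewrite -[RHS]vAi; apply: eq_bigr => j _; rewrite mxE cv.
(* If [q] vanished on the whole ball, independence of the slanted waves would force [v = 0]. *)
have q0 : 0 < helmholtz_norm kappa q.
  have [[x [Bx xN0]]|nx] := pselect (exists x, B1 x /\ jval q x != 0).
    exact: wave_sum_norm_gt0 Bx xN0.
  exfalso; move/eqP: vN0; apply; apply: (slanted_sum_eq0 k0 cv) => x Bx.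
  by apply/eqP; apply: contra_notT nx => xN0; exists x.
pose r := ((helmholtz_norm kappa q)^-1)%:C%C.
pose f := jet_axpy r q jet0.
have hf : helmholtz_space kappa f by apply: helmholtz_space_axpy => //; exact: jet0_helmholtz.
have [q2 f2 z2] := And3 (helmholtz_space_L2 hq) (helmholtz_space_L2 hf)
  (helmholtz_space_L2 (jet0_helmholtz kappa)).
have fE u : jet_L2 u -> helmholtz_prod kappa f u = r * helmholtz_prod kappa q u.
  by move=> u2; rewrite helmholtz_prod_axpy// jet0_prod// addr0.
have qq : helmholtz_prod kappa q q = (helmholtz_norm kappa q ^+ 2)%:C%C.
  apply: complex_ext; first by rewrite helmholtz_prod_self.
  have := congr1 (@complex.Im R) (helmholtz_prodC kappa q2 q2).
  by rewrite cIm_conj cImC; lra.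
have ff : helmholtz_prod kappa f f = 1.
  rewrite fE// (helmholtz_prodC _ f2 q2) fE// qq.
  apply: complex_ext; rewrite !ReImE /r !cReC !cImC /=; field; by rewrite gt_eqF.
have fe i : (i < N)%N -> helmholtz_prod kappa f (e i) = 0.
  by move=> iN; rewrite fE ?qe ?mulr0//; exact: helmholtz_space_L2 (he i iN).
have ef i : (i < N)%N -> helmholtz_prod kappa (e i) f = 0.
  move=> iN; have e2 := helmholtz_space_L2 (he i iN).
  by rewrite (helmholtz_prodC _ f2 e2) fe// conjc0.
exists (fun i => if (i < N)%N then e i else f); split=> [i iN|i j].
  by case: ifP => // h; exact: he.
rewrite !ltnS leq_eqVlt => /predU1P[->|iN]; rewrite leq_eqVlt => /predU1P[->|jN].
- by rewrite ltnn eqxx.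
- by rewrite ltnn jN fe// gtn_eqF.
- by rewrite ltnn iN ef// ltn_eqF.
- by rewrite iN jN ee.
Qed.

End orthonormal_waves.

(** * Instability *)

Section instability.
Context {R : realType}.
Local Notation sigma := (@sphere_measure R).
Local Notation Theta := (@Theta R).
Local Notation B1 := (@unit_ball R).
Implicit Types (kappa : R) (u w : @jet R).

Lemma normc_conj (z : R[i]) : normc (conjc z) = normc z.
Proof. by case: z => a b; rewrite /= sqrrN. Qed.

Lemma measurable_Theta : measurable Theta.
Proof. by apply: measurableX; exact: measurable_itv. Qed.

Lemma analysis_L2 kappa u : 0 < kappa -> helmholtz_space kappa u ->
  L2 sigma Theta (fun theta => helmholtz_prod kappa u (plane_wave kappa theta)).
Proof.
move=> k0 hu; have [_ mT [B [_ HB]]] := plane_wave_bessel k0.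
by split; [exact: mT|apply: le_lt_trans (HB _ hu) _; exact: ltry].
Qed.

Lemma sum_analysis_le kappa (e : nat -> jet) (N : nat) : 0 < kappa ->
  (forall i, (i < N)%N -> helmholtz_space kappa (e i)) ->
  (forall i j, (i < N)%N -> (j < N)%N ->
    helmholtz_prod kappa (e i) (e j) = (i == j)%:R) ->
  \sum_(i < N) L2norm sigma Theta
    (fun theta => helmholtz_prod kappa (e i) (plane_wave kappa theta)) ^+ 2 <=
  2 * fine (@lebesgue3 R B1) * fine (sigma Theta).
Proof.
move=> k0 he ee; have mT := measurable_Theta.
pose g (i : 'I_N) theta := normc (helmholtz_prod kappa (e i) (plane_wave kappa theta)) ^+ 2.
have ig i : sigma.-integrable Theta (EFin \o g i).
  have [[mr mi] gfin] := (analysis_L2 k0 (he i (ltn_ord i))).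
  apply/integrableP; split.
    apply/measurable_EFinP; rewrite /g; under eq_fun do rewrite normc_sqr.
    by apply: measurable_funD; exact: measurable_funX.
  by under eq_integral do rewrite /= ger0_norm ?sqr_ge0//.
have -> : \sum_(i < N) L2norm sigma Theta
    (fun theta => helmholtz_prod kappa (e i) (plane_wave kappa theta)) ^+ 2 =
    \int[sigma]_(theta in Theta) \sum_(i < N) g i theta.
  rewrite Rintegral_sum//; apply: eq_bigr => i _; rewrite sqr_sqrtr//.
  by apply: Rintegral_ge0 => x _; exact: sqr_ge0.
rewrite -Rintegral_cst//; apply: le_Rintegral => //.
- exact: integrable_sum_EFin.
- apply/integrableP; split; first exact: measurable_cst.
  under eq_integral do rewrite /=.
  by rewrite integral_cst// lte_mul_pinfty// -ge0_fin_numE// fin_num_measure.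
move=> theta _; have p2 := pwave_L2 kappa (direction theta).
rewrite -(pwave_norm k0 (dot_direction theta)).
rewrite (eq_bigr (fun i : 'I_N => normc (helmholtz_prod kappa (plane_wave kappa theta) (e i)) ^+ 2)).
  by apply: helmholtz_Bessel => // i iN; exact: helmholtz_space_L2 (he i iN).
move=> i _; rewrite /g (@helmholtz_prodC _ kappa (plane_wave kappa theta)) ?normc_conj//.
exact: helmholtz_space_L2 (he i (ltn_ord i)).
Qed.

Lemma synthesis_Cauchy_Schwarz kappa u w (v : _ -> R[i]) : 0 < kappa ->
  helmholtz_space kappa u -> L2 sigma Theta v ->
  synthesis kappa sigma Theta (plane_wave kappa) v w ->
  normc (helmholtz_prod kappa w u) ^+ 2 <= L2norm sigma Theta v ^+ 2 *
    L2norm sigma Theta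
      (fun theta => helmholtz_prod kappa u (plane_wave kappa theta)) ^+ 2.
Proof.
move=> k0 hu v2 [hw wE]; rewrite wE//.
have -> : (fun theta => v theta * helmholtz_prod kappa (plane_wave kappa theta) u) =
    (fun theta => v theta * conjc (helmholtz_prod kappa u (plane_wave kappa theta))).
  apply/funext => theta; rewrite (@helmholtz_prodC _ _ u)//.
    exact: helmholtz_space_L2 hu.
  exact: pwave_L2.
apply: L2_Cauchy_Schwarz => //; first exact: measurable_Theta.
exact: analysis_L2.
Qed.

(** Already the real part is at least 1/2. *)
Lemma far_from_0_near_1 (x y : R) :
  (- x + 1) ^+ 2 + (- y) ^+ 2 <= 2^-1 ^+ 2 -> 4^-1 <= x ^+ 2 + y ^+ 2.
Proof.
have := sqr_ge0 y; rewrite sqrrN !expr2 => y2 xy.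
have xh : 2^-1 <= x by nra.
nra.
Qed.

(** For the unit vector u, (u - w, u) = 1 - (w, u), which Cauchy-Schwarz bounds by 1/2. *)
Lemma prod_approximant kappa u w : helmholtz_space kappa u -> helmholtz_space kappa w ->
  helmholtz_prod kappa u u = 1 ->
  helmholtz_norm kappa (jet_sub u w) <= 2^-1 * helmholtz_norm kappa u ->
  4^-1 <= normc (helmholtz_prod kappa w u) ^+ 2.
Proof.
move=> hu hw uu le; have [u2 w2] := (helmholtz_space_L2 hu, helmholtz_space_L2 hw).
have n1 : helmholtz_norm kappa u ^+ 2 = 1 by rewrite -helmholtz_prod_self// uu.
have n0 : 0 <= helmholtz_norm kappa u by exact: sqrtr_ge0.
have {}n1 : helmholtz_norm kappa u = 1 by nra.
rewrite jet_subE in le; have s2 := jet_axpy_L2 (-1) w2 u2.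
have := helmholtz_Cauchy_Schwarz kappa s2 u2.
rewrite helmholtz_prod_axpy// uu mulN1r n1 mulr1.
move=> /le_trans /(_ le); rewrite n1 mulr1 => h.
have : normc (- helmholtz_prod kappa w u + 1) ^+ 2 <= 2^-1 ^+ 2.
  by rewrite lerXn2r ?nnegrE ?normc_nneg ?invr_ge0.
case: (helmholtz_prod kappa w u) => x y; rewrite !normc_sqr /= addr0 => xy.
exact: far_from_0_near_1 xy.
Qed.

End instability.

Theorem theorem3p14 (R : realType) (kappa : R) (kappa_gt0 : 0 < kappa) :
  bessel_family kappa (@sphere_measure R) Theta (plane_wave kappa) /\
  ~ stable_continuous_approximation kappa (@sphere_measure R) Theta
      (plane_wave kappa).
Proof.
split; first exact: plane_wave_bessel.
have h2 : 0 < 2^-1 :> R by rewrite invr_gt0.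
move=> /(_ _ h2)[C [C0 stab]].
pose M := 2 * fine (@lebesgue3 R unit_ball) * fine (@sphere_measure R Theta).
have M0 : 0 <= M by rewrite !mulr_ge0// fine_ge0.
(* Tolerance 1/2 makes each of the N orthonormal vectors cost at least 1/4, while the total is at
   most C^2 M. *)
pose N := Num.bound (4 * C ^+ 2 * M).
have NM : 4 * C ^+ 2 * M < N%:R.
  by apply: archi_boundP; apply: mulr_ge0 => //; apply: mulr_ge0 => //; exact: sqr_ge0.
have [e [he ee]] := @orthonormal_waves R kappa N kappa_gt0.
have low (i : 'I_N) : 4^-1 <= C ^+ 2 * L2norm (@sphere_measure R) Theta
    (fun theta => helmholtz_prod kappa (e i) (plane_wave kappa theta)) ^+ 2.
  have hi := he i (ltn_ord i).
  have eii : helmholtz_prod kappa (e i) (e i) = 1 by rewrite ee// eqxx.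
  have [v [w [v2 vw ew vC]]] := stab _ hi.
  have [hw _] := vw.
  apply: (le_trans (prod_approximant hi hw eii ew)).
  apply: (le_trans (synthesis_Cauchy_Schwarz kappa_gt0 hi v2 vw)).
  rewrite ler_wpM2r ?sqr_ge0// lerXn2r ?nnegrE ?sqrtr_ge0//.
  apply: (le_trans vC); rewrite -[leRHS]mulr1 ler_wpM2l//.
  rewrite -(@ler_pXn2r _ 2)// ?nnegrE ?sqrtr_ge0// expr1n.
  by rewrite -helmholtz_prod_self ?eii//; exact: helmholtz_space_L2 hi.
have := sum_analysis_le kappa_gt0 he ee; rewrite -/M => sumM.
have : N%:R * 4^-1 <= C ^+ 2 * M.
  apply: le_trans (ler_wpM2l (sqr_ge0 C) sumM); rewrite mulr_sumr.
  rewrite -[N in N%:R]card_ord -sum1_card natr_sum mulr_suml.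
  by apply: ler_sum => i _; rewrite mul1r.
lra.
Qed.
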